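(* Let $\pi$ be a unitary representation of a discrete group $\Gamma$ on $\mathcal{H}$ and suppose there exists a set of vectors $\mathcal{G}\subseteq\mathcal{H}$ such that $\{\pi(\gamma)g:\gamma\in\Gamma,\,g\in\mathcal{G}\}$ is a minimal system. Then, for every $\gamma\in\Gamma$ with $o(\gamma)=\infty$, the operator $\pi(\gamma)$ is non-reductive, and hence the arc length measure on the unit circle $S_1$ is absolutely continuous with respect to the spectral measure of $\pi(\gamma)$.
   Context: $\mathcal{H}$ is an infinite-dimensional separable complex Hilbert space. The order $o(\gamma)$ of $\gamma\in\Gamma$ is the smallest positive integer $m$ with $\gamma^m=1$, and $o(\gamma)=\infty$ if no such $m$ exists. The system $\{\pi(\gamma)g\}$ is regarded as a family indexed by pairs $(\gamma,g)\in\Gamma\times\mathcal{G}$; a family of vectors is minimal if no member belongs to the closed linear span of the other members. An operator $T$ is reductive if for every closed invariant subspace $V$ of $T$, the orthogonal complement $V^\perp$ is also invariant under $T$; otherwise it is non-reductive. Absolute continuity with respect to the spectral measure $E$ of the unitary operator $\pi(\gamma)$ means: every Borel set $F\subseteq S_1$ with $E(F)=0$ has arc length measure $0$.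
   Formalization: The set 𝒢 is assumed nonempty: for 𝒢 = ∅ the system is empty and vacuously minimal, and the trivial representation of the integers, with every π(γ) the identity (a reductive operator), would contradict the statement. *)

(* Defs.v *)
From HB Require Import structures.
From mathcomp Require Import all_boot all_order all_algebra complex.
From mathcomp Require Import all_classical all_reals all_analysis.

Set Implicit Arguments.
Unset Strict Implicit.
Unset Printing Implicit Defensive.

Import Order.TTheory GRing.Theory Num.Theory.
Import numFieldNormedType.Exports.

Local Open Scope classical_set_scope.
Local Open Scope ring_scope.

(* R[i] carries no topology by itself; seen as a numClosedFieldType it gets the
   topology of its norm. *)
Definition Cplx (R : realType) : numClosedFieldType := R[i].

(* The inner product is linear in the first argument, conjugate-linear in the
   second one. *)
HB.mixin Record NormedModule_isHilbert (R : realType) H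
    of CompleteNormedModule (Cplx R) H := {
  inner : {dot H for @Num.conj (Cplx R)};
  inner_norm : forall x : H, `|x| ^+ 2 = inner x x }.

#[short(type="hilbertType")]
HB.structure Definition Hilbert (R : realType) :=
  { H of NormedModule_isHilbert R H & CompleteNormedModule (Cplx R) H }.

Section hilbert_space.
Context {R : realType} {H : hilbertType R}.
Implicit Types (A V : set H) (T U : {linear H -> H}).

Definition lin_span A : set H :=
  [set x | exists (n : nat) (c : 'I_n -> Cplx R) (v : 'I_n -> H),
     (forall i, A (v i)) /\ x = \sum_(i < n) c i *: v i].

Definition closed_span A : set H := closure (lin_span A).

Definition closed_subspace V :=
  [/\ closed V, V 0 & forall (a : Cplx R) x y, V x -> V y -> V (a *: x + y)].

Definition ortho_compl V : set H := [set y | forall x, V x -> inner x y = 0].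

Definition invariant V T := T @` V `<=` V.

Definition reductive T :=
  forall V, closed_subspace V -> invariant V T -> invariant (ortho_compl V) T.

Definition unitary U :=
  (forall y, exists x, U x = y) /\ (forall x y, inner (U x) (U y) = inner x y).

(* The members of the family are distinguished by their indices, not by their
   values. *)
Definition minimal_family (I : Type) (J : set I) (f : I -> H) :=
  forall i, J i -> ~ closed_span (f @` (J `\ i)) (f i).

End hilbert_space.

Definition separable (T : topologicalType) :=
  exists A : set T, countable A /\ dense A.

Definition infinite_dimensional (R : realType) (H : hilbertType R) :=
  forall A : set H, finite_set A -> lin_span A <> [set: H].

Definition infinite_order (G : groupType) (g : G) :=
  forall m : nat, (0 < m)%N -> (g ^+ m)%g <> 1%g.

Definition unitary_representation (R : realType) (H : hilbertType R)
    (G : groupType) (pi : G -> {linear H -> H}) :=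
  [/\ forall g, unitary (pi g),
      forall x, pi 1%g x = x
    & forall g h x, pi (g * h)%g x = pi g (pi h x)].

Record projection_measure (R : realType) (d : measure_display)
    (T : measurableType d) (H : hilbertType R) := ProjectionMeasure {
  pm_fun :> set T -> {linear H -> H};
  pm_idem : forall F, measurable F -> forall x,
    pm_fun F (pm_fun F x) = pm_fun F x;
  pm_selfadjoint : forall F, measurable F -> forall x y,
    inner (pm_fun F x) y = inner x (pm_fun F y);
  pm_set0 : forall x, pm_fun set0 x = 0;
  pm_setT : forall x, pm_fun setT x = x;
  pm_setI : forall F G, measurable F -> measurable G -> forall x,
    pm_fun (F `&` G) x = pm_fun F (pm_fun G x);
  pm_sigma_additive : forall F : nat -> set T,
    (forall n, measurable (F n)) -> trivIset setT F -> forall x,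
    \sum_(i < n) pm_fun (F i) x @[n --> \oo] --> pm_fun (\bigcup_n F n) x }.

Section scalar_measure.
Context {R : realType} {d : measure_display} {T : measurableType d}.
Context {H : hilbertType R} (E : projection_measure T H).

(* As E F is an orthogonal projection, this is F |-> <E(F)x, x>; see
   scalar_measureE. *)
Definition scalar_measure (x : H) (F : set T) : \bar R :=
  (complex.Re (inner (E F x) (E F x)))%:E.

Lemma scalar_measureE x F : measurable F ->
  inner (E F x) x = real_complex R (fine (scalar_measure x F)).
Proof.
move=> mF; rewrite /scalar_measure /= -[in LHS](pm_idem E mF) pm_selfadjoint//.
rewrite -inner_norm; have : `|E F x| ^+ 2 \is Num.real by rewrite realX.
by move/complex_realP => [r ->].
Qed.

Let scalar_measure0 x : scalar_measure x set0 = 0%E.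
Proof. by rewrite /scalar_measure pm_set0 linear0r. Qed.

Let scalar_measure_ge0 x F : (0 <= scalar_measure x F)%E.
Proof.
rewrite /scalar_measure lee_fin -inner_norm.
have : (0 : R[i]) <= `|E F x| ^+ 2 by rewrite exprn_ge0.
by rewrite lecE => /andP[].
Qed.

Let scalar_measure_sigma_additive x : semi_sigma_additive (scalar_measure x).
Proof.
move=> F mF tF mUF.
pose S n : H := \sum_(i < n) E (F i) x.
have orthoE i j : i != j -> inner (E (F i) x) (E (F j) x) = 0.
  move=> ij; rewrite pm_selfadjoint // -pm_setI //.
  have -> : F i `&` F j = set0 by move/trivIsetP : tF; apply.
  by rewrite pm_set0 linear0r.
have SE n : (\sum_(0 <= i < n) scalar_measure x (F i))%E =
    (complex.Re (`|S n| ^+ 2))%:E.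
  rewrite inner_norm /S linear_sumlz big_mkord sumEFin; congr (_%:E).
  rewrite raddf_sum; apply: eq_bigr => i _.
  rewrite linear_sumr (bigD1 i) //= big1 ?addr0 // => j ji.
  by rewrite orthoE // eq_sym.
under eq_fun do rewrite SE.
apply: cvg_EFin; first by near=> n.
rewrite /scalar_measure /= -inner_norm.
have cvgS : `|S n| ^+ 2 @[n --> \oo] --> `|E (\bigcup_n F n) x| ^+ 2.
  have nS := cvg_norm (@pm_sigma_additive _ _ _ _ E _ mF tF x).
  rewrite expr2; under eq_fun do rewrite expr2.
  by apply: cvgM; exact: nS.
apply/cvgrPdist_lt => e e0.
have eC0 : (0 : Cplx R) < real_complex R e by rewrite ltcR.
move/cvgrPdist_lt : cvgS => /(_ _ eC0); apply: filterS => n /=.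
rewrite -raddfB -ltcR; apply: le_lt_trans; rewrite normc_def lecR -sqrtr_sqr.
by rewrite ler_wsqrtr // lerDl sqr_ge0.
Unshelve. all: by end_near. Qed.

HB.instance Definition _ x := isMeasure.Build _ _ _ (scalar_measure x)
  (scalar_measure0 x) (scalar_measure_ge0 x) (@scalar_measure_sigma_additive x).

End scalar_measure.

Section unit_circle.
Context (R : realType).

Definition unit_circle : set (Cplx R) := [set z | `|z| = 1].

Definition circle : Type := set_type unit_circle.

HB.instance Definition _ := Topological.on circle.

Lemma cis_subproof (t : R) : ((cos t +i* sin t)%C : Cplx R) \in unit_circle.
Proof.
rewrite inE /unit_circle /=.
have -> : `|(cos t +i* sin t)%C : Cplx R| =
    real_complex R (Num.sqrt (cos t ^+ 2 + sin t ^+ 2)) by [].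
by rewrite cos2Dsin2 sqrtr1.
Qed.

Definition cis (t : R) : circle :=
  @exist (Cplx R) (fun z => z \in unit_circle) _ (cis_subproof t).

HB.instance Definition _ := isPointed.Build circle (cis 0).

Definition borel_circle := g_sigma_algebraType (@open circle).

HB.instance Definition _ := Measurable.on borel_circle.

(* cis maps [0, 2 pi[ bijectively onto the circle, at unit speed. *)
Definition arc_length (F : set circle) : \bar R :=
  lebesgue_measure (`[0, 2 * pi[ `&` cis @^-1` F).

End unit_circle.

(* U = \int z dE(z), read weakly: <Ux, x> = \int z d<E(z)x, x> for all x, which
   determines U by polarization. *)
Definition spectral_measure_of (R : realType) (H : hilbertType R)
    (U : {linear H -> H}) (E : projection_measure (borel_circle R) H) :=
  forall x, inner (U x) x =
    ((\int[scalar_measure E x]_z complex.Re (set_val z))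
     +i* (\int[scalar_measure E x]_z complex.Im (set_val z)))%C.

(* Absolute continuity of the arc length with respect to E. *)
Definition arc_length_ac (R : realType) (H : hilbertType R)
    (E : projection_measure (borel_circle R) H) :=
  forall F : set (borel_circle R), measurable F ->
    (forall x, E F x = 0) -> arc_length F = 0%E.

(* Main.v *)
Require Import Defs.
From HB Require Import structures.
From mathcomp Require Import all_boot all_order all_algebra complex.
From mathcomp Require Import all_classical all_reals all_analysis.
From mathcomp Require Import measurable_realfun.
From mathcomp Require Import ring lra.

Set Implicit Arguments.
Unset Strict Implicit.
Unset Printing Implicit Defensive.

Import Order.TTheory GRing.Theory Num.Theory.
Import numFieldNormedType.Exports.

Local Open Scope classical_set_scope.
Local Open Scope ring_scope.

(** Put U = pi gamma and fix g in G. As gamma has infinite order, the vectors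
    U^n g are members of the minimal family with different indices, so that
    g does not belong to V, the closed span of the U^n g with n >= 1
    ([minimal_forward_span]). The subspace V is invariant under U. Let p be
    the orthogonal projection of g on V and e = g - p, a nonzero vector of the
    orthogonal complement of V. Since U e = U g - U p, all the vectors U^n e
    with n >= 1 belong to V ([innovation]).

    Hence U is not reductive: otherwise U e would lie both in V and in its
    orthogonal complement, so that U e = 0 and e = 0.

    Moreover <U^n e, e> = 0 for all n >= 1: e is a wandering vector of U. Let
    E be the spectral measure of U. The positive measure <E(.)e, e> has the
    moments <U^n e, e> ([spectral_moments]), hence the same moments as a
    multiple of the arc length ([arc_moments]), and a finite measure on the
    circle is determined by its moments ([circle_measure_unique]). After
    scaling e to a vector v, the arc length is exactly <E(.)v, v>, which
    vanishes on every Borel set F with E(F) = 0.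

    The spectral measure is only known to satisfy <Ux, x> = \int z d<E(z)x, x>.
    The formula for U^n comes from a discretization: first, U commutes with E
    ([spectral_invariant]); then, on the range of E(A) for a set A of small
    diameter around z0, the unitarity of U gives
    |Ux - z0 x|^2 = \int |z - z0|^2 d<E(z)x, x>, so that U^n is close to z0^n
    there; finally, the circle is a finite union of such sets.

    Moments determine a measure for the following reason. Equality of the
    moments gives equality of the integrals of all trigonometric polynomials;
    these form an algebra, and composing a rescaled coordinate with
    (1 - t^n)^(n 2^n), which converges boundedly to the indicator function of
    t < 1/2 on [0, 1], gives the measures of the sets
    {Re z < a, Im z < b}. These sets form a pi-system that generates the Borel
    sets of the circle. *)

(** * Real inner product and squared norm *)

Section RealInner.
Context {R : realType} {H : hilbertType R}.
Implicit Types x y z : H.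

(** The real inner product Re <x, y>, with values in the real field itself, so
    that inequalities between such numbers are inequalities in a total
    order. *)
Definition reip x y : R := complex.Re (inner x y).

(** The squared norm, as a real number. *)
Definition sqn x : R := reip x x.

Lemma innerC x y : inner x y = ((inner y x)^*)%C.
Proof. by rewrite hermC expr0 mul1r. Qed.

Lemma reipC x y : reip x y = reip y x.
Proof. by rewrite /reip innerC; case: (inner y x). Qed.

Lemma reipDl x y z : reip (x + y) z = reip x z + reip y z.
Proof. by rewrite /reip linearDl raddfD. Qed.

Lemma reipDr x y z : reip z (x + y) = reip z x + reip z y.
Proof. by rewrite !(reipC z) reipDl. Qed.

Lemma reipNl x z : reip (- x) z = - reip x z.
Proof. by rewrite /reip linearNl raddfN. Qed.

Lemma reipNr x z : reip z (- x) = - reip z x.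
Proof. by rewrite !(reipC z) reipNl. Qed.

Lemma reipBl x y z : reip (x - y) z = reip x z - reip y z.
Proof. by rewrite reipDl reipNl. Qed.

Lemma reip0l x : reip 0 x = 0.
Proof. by rewrite /reip linear0l. Qed.

Lemma innerZl (a : Cplx R) x y : inner (a *: x) y = a * inner x y.
Proof. by rewrite linearZl_LR. Qed.

Lemma innerZr (a : Cplx R) x y : inner x (a *: y) = (a^*)%C * inner x y.
Proof. by rewrite innerC innerZl rmorphM /= -innerC. Qed.

Lemma reipZl (t : R) x y : reip ((t%:C)%C *: x) y = t * reip x y.
Proof. by rewrite /reip innerZl; case: (inner x y) => a b /=; ring. Qed.

Lemma reipZr (t : R) x y : reip x ((t%:C)%C *: y) = t * reip x y.
Proof. by rewrite reipC reipZl reipC. Qed.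

Definition reipE := (reipDl, reipDr, reipNl, reipNr, reipZl, reipZr).

Lemma inner_sqn x : inner x x = ((sqn x)%:C)%C.
Proof.
by rewrite /sqn /reip RRe_real// -inner_norm realX.
Qed.

Lemma norm_sqn x : `|x| = ((Num.sqrt (sqn x))%:C)%C.
Proof.
have s0 : 0 <= sqn x.
  by rewrite -ler0c -inner_sqn -inner_norm exprn_ge0.
apply/eqP; rewrite -(@eqrXn2 _ 2)// ?ler0c ?sqrtr_ge0//.
by rewrite inner_norm inner_sqn -rmorphXn /= sqr_sqrtr.
Qed.

Lemma sqn_ge0 x : 0 <= sqn x.
Proof. by rewrite -ler0c -inner_sqn -inner_norm exprn_ge0. Qed.

Lemma sqn_eq0 x : sqn x = 0 -> x = 0.
Proof. by move=> x0; apply/eqP; rewrite -normr_eq0 norm_sqn x0 sqrtr0. Qed.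

Lemma sqnD x y : sqn (x + y) = sqn x + sqn y + 2 * reip x y.
Proof. by rewrite /sqn !reipE (reipC y x); ring. Qed.

Lemma sqnB x y : sqn (x - y) = sqn x + sqn y - 2 * reip x y.
Proof. by rewrite /sqn !reipE (reipC y x); ring. Qed.

Lemma sqnZ (a : Cplx R) x : sqn (a *: x) = complex.Re (a * (a^*)%C) * sqn x.
Proof.
rewrite {1}/sqn /reip innerZl innerZr inner_sqn.
by case: a => a b /=; ring.
Qed.

Lemma inner_eq0_reip x y : (forall a : Cplx R, reip (a *: x) y = 0) -> inner x y = 0.
Proof.
move=> h; have := h 1; have := h ((0 -i* 1)%C).
rewrite /reip !innerZl; case: (inner x y) => a b /=.
by rewrite !mul0r !mul1r !mulN1r opprK add0r subr0 => -> ->.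
Qed.

(** A form of the Cauchy-Schwarz inequality. *)
Lemma reip_bound (a b : H) (k : R) : 0 <= k ->
  `|a| <= ((k%:C)%C : Cplx R) * `|b| -> `|reip a b| <= k * sqn b.
Proof.
move=> k0; rewrite !norm_sqn -rmorphM lecR => h.
have {}h : sqn a <= k ^+ 2 * sqn b.
  rewrite -(sqr_sqrtr (sqn_ge0 a)) -(sqr_sqrtr (sqn_ge0 b)) -exprMn.
  by rewrite lerXn2r ?nnegrE ?sqrtr_ge0// mulr_ge0// sqrtr_ge0.
have [k00|k1] := eqVneq k 0.
  move: h; rewrite k00 expr0n mul0r => h.
  have -> : a = 0 by apply: sqn_eq0; apply/eqP; rewrite eq_le h sqn_ge0.
  by rewrite reip0l normr0.
have kp : 0 < k by rewrite lt_neqAle eq_sym k1.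
(* a + k b and a - k b have nonnegative squared norms. *)
have := sqn_ge0 (a + (k%:C)%C *: b); have := sqn_ge0 (a - (k%:C)%C *: b).
rewrite sqnB sqnD reipZr.
have -> : sqn ((k%:C)%C *: b) = k ^+ 2 * sqn b.
  by rewrite /sqn reipZl reipZr mulrA expr2.
move=> h1 h2.
rewrite -(ler_pM2l kp) -[X in X * `|_|](gtr0_norm kp) -normrM ler_norml.
by apply/andP; split; nra.
Qed.

Lemma sqn_cvg (u : nat -> H) (l : H) :
  u n @[n --> \oo] --> l -> sqn (u n) @[n --> \oo] --> sqn l.
Proof.
move=> ul.
have h : Num.sqrt (sqn (u n)) @[n --> \oo] --> Num.sqrt (sqn l).
  apply/cvgrPdist_lt => e e0.
  have eC : (0 : Cplx R) < (e%:C)%C by rewrite ltcR.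
  have nul : `|u n| @[n --> \oo] --> (`|l| : Cplx R) by exact: cvg_norm.
  move/cvgrPdist_lt : nul => /(_ _ eC).
  apply: filterS => n /=.
  by rewrite !norm_sqn -rmorphB normc_def /= expr0n addr0 sqrtr_sqr ltcR.
have sqE x : sqn x = Num.sqrt (sqn x) * Num.sqrt (sqn x).
  by rewrite -expr2 sqr_sqrtr ?sqn_ge0.
rewrite sqE (_ : (fun n => sqn (u n)) =
  fun n => Num.sqrt (sqn (u n)) * Num.sqrt (sqn (u n))); first exact: cvgM.
by apply: funext => n; exact: sqE.
Qed.

(** Completeness, in terms of squared distances. *)
Lemma cauchy_sqn_cvg (u : nat -> H) (d : nat -> R) :
  d n @[n --> \oo] --> 0 -> (forall m n, sqn (u m - u n) <= d m + d n) ->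
  exists l : H, u n @[n --> \oo] --> l.
Proof.
move=> d0 ud; apply/cvg_ex.
apply: cauchy_cvg; apply/cauchy_ballP => e e0.
have [r er] : exists r : R, e = (r%:C)%C.
  by exists (complex.Re e); rewrite RRe_real// gtr0_real.
move: e0; rewrite er ltcR => r0.
have r20 : 0 < r ^+ 2 / 2 by rewrite divr_gt0// exprn_gt0.
move/cvgrPdist_lt : d0 => /(_ _ r20) dn.
rewrite near_map2; near=> m n => /=.
rewrite -ball_normE /= norm_sqn ltcR -(gtr0_norm r0) -sqrtr_sqr ltr_sqrt.
  apply: (le_lt_trans (ud _ _)).
  have -> : r ^+ 2 = r ^+ 2 / 2 + r ^+ 2 / 2 by field.
  apply: ltrD; (apply: le_lt_trans (ler_norm _) _); rewrite -normrN -sub0r.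
    by near: m.
  by near: n.
by rewrite exprn_gt0.
Unshelve. all: end_near. Qed.

End RealInner.

(** * Orthogonal projection on a closed subspace *)

Section Projection.
Context {R : realType} {H : hilbertType R}.
Variable V : set H.
Hypothesis Vsub : closed_subspace V.

Let V0 : V 0. Proof. by case: Vsub. Qed.
Let VZ a x : V x -> V (a *: x).
Proof. by case: Vsub => _ _ h Vx; rewrite -[_ *: _]addr0; exact: h. Qed.
Let VD x y : V x -> V y -> V (x + y).
Proof. by case: Vsub => _ _ h Vx Vy; rewrite -[x]scale1r; exact: h. Qed.
Lemma nearest_point_ortho (e : H) :
  (forall v, V v -> sqn e <= sqn (e - v)) -> ortho_compl V e.
Proof.
move=> emin.
suff h v : V v -> reip v e = 0.
  by move=> v Vv; apply: inner_eq0_reip => a; exact/h/VZ.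
move=> Vv; set c := reip v e; set q := sqn v.
have q0 : 0 <= q by exact: sqn_ge0.
(* The competitor is e - t c v; for t = 1 / (q + 1), the number t^2 q - 2 t is
   negative, even when q = 0. *)
have /emin : V (((c / (q + 1))%:C)%C *: v) by exact: VZ.
rewrite sqnB reipZr (reipC e) -/c.
have -> : sqn (((c / (q + 1))%:C)%C *: v) = (c / (q + 1)) ^+ 2 * q.
  by rewrite /sqn reipZl reipZr mulrA expr2.
rewrite -addrA lerDl.
have -> : (c / (q + 1)) ^+ 2 * q - 2 * (c / (q + 1) * c) =
   - (c ^+ 2 * (q + 2) / (q + 1) ^+ 2).
  by field; lra.
rewrite oppr_ge0 => h.
have : c ^+ 2 * (q + 2) <= 0.
  have : 0 < (q + 1) ^+ 2 by rewrite exprn_gt0//; lra.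
  by move=> p; move: h; rewrite pmulr_lle0 ?invr_gt0.
rewrite pmulr_lle0; last lra.
move=> h2; apply/eqP; rewrite -sqrf_eq0.
by rewrite eq_le h2 sqr_ge0.
Qed.

Lemma nearest_point_exists (g : H) :
  exists2 p, V p & forall v, V v -> sqn (g - p) <= sqn (g - v).
Proof.
pose S := [set sqn (g - v) | v in V].
have S0 : S !=set0 by exists (sqn (g - 0)), 0.
have lS : has_inf S by split => //; exists 0 => _ [v _ <-]; exact: sqn_ge0.
pose D := inf S.
have DS v : V v -> D <= sqn (g - v).
  by move=> Vv; apply: ge_inf; [exact: lS.2|exists v].
have /choice[u uP] : forall n : nat, exists v, V v /\ sqn (g - v) < D + n.+1%:R^-1.
  move=> n.
  have /(inf_adherent)/(_ lS)[_ [v Vv <-] h] : 0 < n.+1%:R^-1 :> R by [].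
  by exists v.
have [p up] : exists p : H, u n @[n --> \oo] --> p.
  apply: (@cauchy_sqn_cvg _ _ _ (fun n => 2 * n.+1%:R^-1)).
    rewrite -[X in _ --> X](mulr0 2).
    by apply: cvgMl_tmp; exact: cvg_harmonic.
  (* By the parallelogram identity and as (u m + u n) / 2 belongs to V, a
     minimizing sequence is a Cauchy sequence. *)
  move=> m n; have [Vm um] := uP m; have [Vn un] := uP n.
  have : V ((2^-1 : Cplx R) *: (u m + u n)) by apply: VZ; exact: VD.
  move=> /DS.
  have -> : g - 2^-1 *: (u m + u n) = (((2^-1 : R)%:C)%C : Cplx R) *: ((g - u m) + (g - u n)).
    rewrite fmorphV /= rmorph_nat addrACA -opprD scalerBr -mulr2n.
    by rewrite -[g *+ 2]scaler_nat scalerA mulVf ?scale1r// pnatr_eq0.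
  rewrite [X in _ <= X]/sqn reipZl reipZr -/(sqn _).
  have -> : u m - u n = (g - u n) - (g - u m).
    by rewrite opprB [RHS]addrC addrA subrK.
  move: um un; set a := g - u m; set b := g - u n => um un.
  rewrite (sqnD a) (sqnB b) (reipC b) /= => h.
  move: (m.+1%:R^-1) (n.+1%:R^-1) um un => dm dn um un; lra.
exists p.
  case: Vsub => cV _ _.
  by apply: (closed_cvg _ cV _ _ up); apply: nearW => n; exact: (uP n).1.
move=> v /DS; apply: le_trans.
have h1 : sqn (g - u n) @[n --> \oo] --> sqn (g - p).
  by apply: sqn_cvg; apply: cvgB => //; exact: cvg_cst.
have h2 : D + n.+1%:R^-1 @[n --> \oo] --> D.
  by rewrite -[X in _ --> X]addr0; apply: cvgD; [exact: cvg_cst|exact: cvg_harmonic].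
apply: (ler_cvg_to h1 h2); apply: nearW => n; exact/ltW/(uP n).2.
Qed.

Lemma orthogonal_projection (g : H) :
  exists2 p, V p & ortho_compl V (g - p).
Proof.
have [p Vp pmin] := nearest_point_exists g; exists p => //.
apply: nearest_point_ortho => v Vv.
by rewrite -addrA -opprD; apply/pmin/VD.
Qed.

End Projection.

(** * Closed spans and unitary operators *)

Section Span.
Context {R : realType} {H : hilbertType R}.
Implicit Types (A V : set H).

Lemma closure_normP A (x : H) :
  closure A x <-> forall e : R, 0 < e -> exists2 v, A v & `|x - v| < (e%:C)%C.
Proof.
split=> [cA e e0|h B /nbhs_ballP[e /= e0 xeB]].
  have eC : (0 : Cplx R) < (e%:C)%C by rewrite ltcR.
  have [v [Av]] := cA _ (nbhsx_ballx x _ eC).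
  by rewrite -ball_normE => ?; exists v.
have re : (complex.Re e)%:C%C = e by rewrite RRe_real// gtr0_real.
have [|v Av xv] := h (complex.Re e); first by rewrite -ltcR re.
by exists v; split=> //; apply: xeB; rewrite -ball_normE /= -re.
Qed.

Lemma subset_lin_span A : A `<=` lin_span A.
Proof.
move=> x Ax; exists 1%N, (fun=> 1), (fun=> x); split=> //.
by rewrite big_ord1 scale1r.
Qed.

Lemma lin_span0 A : lin_span A 0.
Proof. by exists 0%N, (fun=> 0), (fun=> 0); split=> [[]|]; rewrite ?big_ord0. Qed.

Lemma lin_spanP A (a : Cplx R) x y :
  lin_span A x -> lin_span A y -> lin_span A (a *: x + y).
Proof.
move=> [n [c [v [Av ->]]]] [m [d [w [Aw ->]]]].
(* The two linear combinations are concatenated. *)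
exists (n + m)%N.
exists (fun i => match fintype.split i with inl j => a * c j | inr j => d j end).
exists (fun i => match fintype.split i with inl j => v j | inr j => w j end).
split=> [i|]; first by case: fintype.splitP.
rewrite big_split_ord /= scaler_sumr; congr (_ + _); apply: eq_bigr => i _.
  by rewrite (unsplitK (inl i)) scalerA.
by rewrite (unsplitK (inr i)).
Qed.

Lemma closed_span_subspace A : closed_subspace (closed_span A).
Proof.
split; first exact: closed_closure.
  exact/subset_closure/lin_span0.
move=> a x y /closure_normP cx /closure_normP cy; apply/closure_normP => e e0.
pose r : R := complex.Re `|a|; pose k : R := 2 * (r + 1).
have aE : `|a| = r%:C%C by rewrite RRe_real.
have a0 : 0 <= r by rewrite -ler0c -aE.
have [|v Av xv] := cx (e / k); first by rewrite divr_gt0// /k; lra.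
have [|w Aw yw] := cy (e / 2); first by rewrite divr_gt0.
exists (a *: v + w); first exact: lin_spanP.
rewrite opprD addrACA -scalerBr (le_lt_trans (ler_normD _ _))//.
have -> : (e%:C)%C = ((e / 2)%:C)%C + ((e / 2)%:C)%C.
  by rewrite -rmorphD /=; congr (_%:C)%C; field.
apply: ler_ltD => //; rewrite normrZ.
apply: (le_trans (ler_wpM2l _ (ltW xv))) => //.
rewrite aE -rmorphM lecR /k /=.
have -> : r * (e / (2 * (r + 1))) = e / 2 * (r / (r + 1)) by field; lra.
rewrite ler_piMr//; first by rewrite divr_ge0// ltW.
by rewrite ler_pdivrMr; lra.
Qed.

Lemma unitary_sqn (U : {linear H -> H}) x : unitary U -> sqn (U x) = sqn x.
Proof. by move=> [_ h]; rewrite /sqn /reip h. Qed.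

Lemma unitary_norm (U : {linear H -> H}) x : unitary U -> `|U x| = `|x|.
Proof. by move=> u; rewrite !norm_sqn unitary_sqn. Qed.

Lemma closed_span_invariant (U : {linear H -> H}) A : unitary U ->
  Defs.invariant A U -> Defs.invariant (closed_span A) U.
Proof.
move=> uU AU _ [x cx <-]; apply/closure_normP => e e0.
move/closure_normP : cx => /(_ _ e0)[v [n [c [w [Aw ->]]]] xv].
exists (U (\sum_(i < n) c i *: w i)); last by rewrite -linearB unitary_norm.
exists n, c, (fun i => U (w i)); split=> [i|]; first by apply: AU; exists (w i).
by rewrite linear_sum; apply: eq_bigr => i _; rewrite linearZ.
Qed.

Lemma ortho_compl_self V x : V x -> ortho_compl V x -> x = 0.
Proof. by move=> Vx /(_ _ Vx) xx; apply: sqn_eq0; rewrite /sqn /reip xx. Qed.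

End Span.

(** * The forward span of a vector and its wandering vectors *)

Section Wandering.
Context {R : realType} {H : hilbertType R} (U : {linear H -> H}).
Hypothesis uU : unitary U.

(** The closed span of U g, U^2 g, U^3 g, ... (without g itself). *)
Definition forward_span (g : H) : set H :=
  closed_span (range (fun n => iter n.+1 U g)).

Variable g : H.
Let V := forward_span g.

Lemma forward_span_subspace : closed_subspace V.
Proof. exact: closed_span_subspace. Qed.

Lemma forward_span_iter n : V (iter n.+1 U g).
Proof. by apply: subset_closure; apply: subset_lin_span; exists n. Qed.

Lemma forward_span_invariant : Defs.invariant V U.
Proof. by apply: closed_span_invariant => // _ [_ [n _ <-] <-]; exists n.+1. Qed.

(** The component e of g orthogonal to the forward span of g. *)
Lemma innovation : ~ V g ->
  exists e, [/\ e != 0, ortho_compl V e & forall n, V (iter n.+1 U e)].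
Proof.
move=> Vg; have [p Vp pV] := orthogonal_projection forward_span_subspace g.
have Ue : V (U (g - p)).
  case: forward_span_subspace => _ _ h.
  rewrite linearB -scaleN1r addrC; apply: h; last exact: (@forward_span_iter 0%N).
  by apply: forward_span_invariant; exists p.
exists (g - p); split=> //.
  by apply/eqP => /subr0_eq gp; apply: Vg; rewrite gp.
elim=> [//|n ih]; rewrite iterS; apply: forward_span_invariant.
by exists (iter n.+1 U (g - p)).
Qed.

Lemma forward_span_nonreductive : ~ V g -> ~ reductive U.
Proof.
move=> /innovation[e [e0 eV Ve]] /(_ _ forward_span_subspace).
move=> /(_ forward_span_invariant) red.
have /ortho_compl_self : V (U e) by exact: (Ve 0%N).
move=> /(_ (red _ _)) Ue0; case/eqP: e0; apply: sqn_eq0.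
by rewrite -(unitary_sqn _ uU) Ue0 ?/sqn ?reip0l.
Qed.

Lemma wandering_vector : ~ V g ->
  exists2 e, e != 0 & forall n, inner (iter n.+1 U e) e = 0.
Proof. by move=> /innovation[e [e0 eV Ve]]; exists e => // n; exact/eV/Ve. Qed.

End Wandering.

Lemma unitary_representation_iter (R : realType) (H : hilbertType R)
    (Gamma : groupType) (pi : Gamma -> {linear H -> H}) (gamma : Gamma) n g :
  unitary_representation pi -> iter n (pi gamma) g = pi (gamma ^+ n)%g g.
Proof.
move=> [_ pi1 piM]; elim: n => [|n ih]; first by rewrite expg0 pi1.
by rewrite iterS ih expgS piM.
Qed.

Lemma minimal_forward_span (R : realType) (H : hilbertType R)
    (Gamma : groupType) (pi : Gamma -> {linear H -> H})
    (pi_unitary : unitary_representation pi) (G : set H)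
    (pi_minimal : minimal_family (setT `*` G)
                    (fun p : Gamma * H => pi p.1 p.2))
    (gamma : Gamma) (gamma_infinite : infinite_order gamma) g :
  G g -> ~ forward_span (pi gamma) g g.
Proof.
move=> Gg; have [_ pi1 _] := pi_unitary.
have := pi_minimal (1%g, g); rewrite /= pi1 => /(_ (conj I Gg)); apply: contra_not.
apply: closureS => x [n [c [v [Av ->]]]]; exists n, c, v; split=> // i.
have [m _ <-] := Av i; exists ((gamma ^+ m.+1)%g, g) => /=.
  split=> // -[]; exact: gamma_infinite.
by rewrite -iterS (unitary_representation_iter _ _ _ pi_unitary).
Qed.

(** * Coordinates on the circle *)

Section Coordinates.
Context {R : realType}.

Lemma continuous_Re : continuous (fun z : Cplx R => complex.Re z : R).
Proof.
move=> z; apply/(@cvgrPdist_lt _ _ _ _ (nbhs_filter z)) => e e0; apply/nbhs_ballP.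
exists (e%:C)%C => [/=|w]; rewrite ?ltcR// -ball_normE /= => zw.
by rewrite -raddfB -ltcR; apply: le_lt_trans (normc_ge_Re _) zw.
Qed.

Lemma continuous_Im : continuous (fun z : Cplx R => complex.Im z : R).
Proof.
move=> z; apply/(@cvgrPdist_lt _ _ _ _ (nbhs_filter z)) => e e0; apply/nbhs_ballP.
exists (e%:C)%C => [/=|w]; rewrite ?ltcR// -ball_normE /= => zw.
rewrite -raddfB -ltcR; apply: le_lt_trans zw.
by rewrite normc_def lecR -sqrtr_sqr ler_wsqrtr// lerDr sqr_ge0.
Qed.

Lemma norm_le_ReDIm (z : Cplx R) :
  `|z| <= ((`|complex.Re z| + `|complex.Im z|)%:C)%C.
Proof.
rewrite normc_def lecR.
have <- := @ger0_norm _ (`|complex.Re z| + `|complex.Im z|).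
  2: by rewrite addr_ge0.
rewrite -(sqrtr_sqr (_ + _)) ler_wsqrtr//.
rewrite sqrrD !real_normK ?num_real// -addrA lerD2l lerDr.
by rewrite mulrn_wge0// mulr_ge0.
Qed.

(** The coordinates of a point of the circle. *)
Definition cx (z : borel_circle R) : R := complex.Re (set_val z).
Definition cy (z : borel_circle R) : R := complex.Im (set_val z).

Lemma set_val_continuous : continuous (set_val : circle R -> Cplx R).
Proof. exact: initial_continuous. Qed.

Lemma cx_continuous : continuous (cx : circle R -> R).
Proof.
by move=> z; apply: (continuous_comp (@set_val_continuous z)); exact: continuous_Re.
Qed.

Lemma cy_continuous : continuous (cy : circle R -> R).
Proof.
by move=> z; apply: (continuous_comp (@set_val_continuous z)); exact: continuous_Im.
Qed.

Lemma continuous_circle_measurable (f : borel_circle R -> R) :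
  continuous (f : circle R -> R) -> measurable_fun setT f.
Proof.
move=> /continuousP cf; apply: (measurability _ (RGenOpens.measurableE R)).
move=> _ [_ [a [b ->] <-]]; rewrite setTI; apply: sub_sigma_algebra.
exact/cf/interval_open.
Qed.

Lemma measurable_cx : measurable_fun setT cx.
Proof. by apply: continuous_circle_measurable; exact: cx_continuous. Qed.

Lemma measurable_cy : measurable_fun setT cy.
Proof. by apply: continuous_circle_measurable; exact: cy_continuous. Qed.

Lemma norm_set_val (z : borel_circle R) : `|set_val z : Cplx R| = 1.
Proof. exact: (set_valP z). Qed.

Lemma norm_pow_diff (z z0 : borel_circle R) n :
  `|(set_val z : Cplx R) ^+ n - set_val z0 ^+ n| <=
  n%:R * `|(set_val z : Cplx R) - set_val z0|.
Proof.
elim: n => [|n ih]; first by rewrite !expr0 subrr normr0 mul0r.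
have -> : (set_val z : Cplx R) ^+ n.+1 - set_val z0 ^+ n.+1 =
  set_val z * (set_val z ^+ n - set_val z0 ^+ n) +
  (set_val z - set_val z0) * set_val z0 ^+ n.
  by rewrite mulrBr -exprS mulrBl -exprS addrA subrK.
rewrite (le_trans (ler_normD _ _))// !normrM normrX !norm_set_val expr1n mulr1 mul1r.
by rewrite -natr1 mulrDl mul1r lerD2r.
Qed.

Lemma cx2Dcy2 z : cx z ^+ 2 + cy z ^+ 2 = 1.
Proof.
have := norm_set_val z.
rewrite normc_def => -[h]; rewrite -[LHS]sqr_sqrtr ?h ?expr1n//.
by rewrite addr_ge0// sqr_ge0.
Qed.

Lemma set_val_circle z : (set_val z : Cplx R) = (cx z +i* cy z)%C.
Proof. by rewrite /cx /cy; case: (set_val z). Qed.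

End Coordinates.

(** * Trigonometric polynomials *)

Lemma bounded_integrable d (T : measurableType d) (R : realType)
    (m : {finite_measure set T -> \bar R}) (f : T -> R) :
  measurable_fun setT f -> (exists M, forall z, `|f z| <= M) ->
  m.-integrable setT (EFin \o f).
Proof.
move=> mf [M fM]; apply: measurable_bounded_integrable => //.
  by rewrite ltey_eq fin_num_measure.
exists M; split; first exact: num_real.
by move=> N MN z _ /=; apply: le_trans (fM z) (ltW MN).
Qed.

Section TrigPoly.
Context {R : realType}.
Implicit Types (f g : borel_circle R -> R).

(** The real functions Re z^n and Im z^n; at cis t, these are cos (n t) and
    sin (n t). *)
Definition re_pow n (z : borel_circle R) : R := complex.Re ((set_val z : Cplx R) ^+ n).
Definition im_pow n (z : borel_circle R) : R := complex.Im ((set_val z : Cplx R) ^+ n).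

Lemma re_powS n z : re_pow n.+1 z = cx z * re_pow n z - cy z * im_pow n z.
Proof.
by rewrite /re_pow /im_pow exprS set_val_circle; case: (_ ^+ n) => a b.
Qed.

Lemma im_powS n z : im_pow n.+1 z = cx z * im_pow n z + cy z * re_pow n z.
Proof.
by rewrite /re_pow /im_pow exprS set_val_circle; case: (_ ^+ n) => a b.
Qed.

Lemma re_pow0 z : re_pow 0 z = 1. Proof. by rewrite /re_pow expr0. Qed.
Lemma im_pow0 z : im_pow 0 z = 0. Proof. by rewrite /im_pow expr0. Qed.

Lemma re_pow2Dim_pow2 n z : re_pow n z ^+ 2 + im_pow n z ^+ 2 = 1.
Proof.
elim: n => [|n ih]; first by rewrite re_pow0 im_pow0 expr1n expr0n addr0.
rewrite re_powS im_powS.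
transitivity ((cx z ^+ 2 + cy z ^+ 2) * (re_pow n z ^+ 2 + im_pow n z ^+ 2)).
  by ring.
by rewrite ih cx2Dcy2 mulr1.
Qed.

Lemma re_pow_le1 n z : `|re_pow n z| <= 1.
Proof.
rewrite -(@expr_le1 _ 2)// real_normK ?num_real//.
by rewrite -(re_pow2Dim_pow2 n z) lerDl sqr_ge0.
Qed.

Lemma im_pow_le1 n z : `|im_pow n z| <= 1.
Proof.
rewrite -(@expr_le1 _ 2)// real_normK ?num_real//.
by rewrite -(re_pow2Dim_pow2 n z) lerDr sqr_ge0.
Qed.

(** The real span of the functions Re z^n and Im z^n, for n >= 0. *)
Inductive trigpoly : (borel_circle R -> R) -> Prop :=
| trig_re n : trigpoly (re_pow n)
| trig_im n : trigpoly (im_pow n)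
| trig_add f g : trigpoly f -> trigpoly g -> trigpoly (fun z => f z + g z)
| trig_scale c f : trigpoly f -> trigpoly (fun z => c * f z).

Lemma trig_ext f g : trigpoly f -> f =1 g -> trigpoly g.
Proof. by move=> tf /funext <-. Qed.

Lemma trig_cst c : trigpoly (fun=> c).
Proof. by apply: trig_ext (trig_scale c (trig_re 0)) _ => z; rewrite re_pow0 mulr1. Qed.

Lemma trig_cx : trigpoly cx.
Proof. by apply: trig_ext (trig_re 1) _ => z; rewrite /re_pow expr1. Qed.

Lemma trig_cy : trigpoly cy.
Proof. by apply: trig_ext (trig_im 1) _ => z; rewrite /im_pow expr1. Qed.

(** The product formulas for Re z Re z^n and Re z Im z^n use
    Re z^2 + Im z^2 = 1; for instance, 2 Re z Re z^n is the sum of Re z^(n+1)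
    and Re z^(n-1). *)
Lemma trig_mul_cx f : trigpoly f -> trigpoly (fun z => cx z * f z).
Proof.
elim=> [[|n]|[|n]|{}f g _ ihf _ ihg|c {}f _ ih].
- by apply: trig_ext trig_cx _ => z; rewrite re_pow0 mulr1.
- apply: trig_ext (trig_scale 2^-1 (trig_add (trig_re n.+2) (trig_re n))) _ => z.
  rewrite 2!re_powS im_powS.
  transitivity (cx z * (cx z * re_pow n z - cy z * im_pow n z) +
    2^-1 * (1 - (cx z ^+ 2 + cy z ^+ 2)) * re_pow n z).
    by field.
  by rewrite cx2Dcy2 subrr mulr0 mul0r addr0.
- by apply: trig_ext (trig_cst 0) _ => z; rewrite im_pow0 mulr0.
- apply: trig_ext (trig_scale 2^-1 (trig_add (trig_im n.+2) (trig_im n))) _ => z.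
  rewrite 2!im_powS re_powS.
  transitivity (cx z * (cx z * im_pow n z + cy z * re_pow n z) +
    2^-1 * (1 - (cx z ^+ 2 + cy z ^+ 2)) * im_pow n z).
    by field.
  by rewrite cx2Dcy2 subrr mulr0 mul0r addr0.
- by apply: trig_ext (trig_add ihf ihg) _ => z; rewrite mulrDr.
- by apply: trig_ext (trig_scale c ih) _ => z; rewrite mulrCA.
Qed.

Lemma trig_mul_cy f : trigpoly f -> trigpoly (fun z => cy z * f z).
Proof.
elim=> [[|n]|[|n]|{}f g _ ihf _ ihg|c {}f _ ih].
- by apply: trig_ext trig_cy _ => z; rewrite re_pow0 mulr1.
- apply: trig_ext (trig_scale 2^-1 (trig_add (trig_im n.+2)
    (trig_scale (-1) (trig_im n)))) _ => z.
  rewrite 2!im_powS re_powS.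
  transitivity (cy z * (cx z * re_pow n z - cy z * im_pow n z) +
    2^-1 * ((cx z ^+ 2 + cy z ^+ 2) - 1) * im_pow n z).
    by field.
  by rewrite cx2Dcy2 subrr mulr0 mul0r addr0.
- by apply: trig_ext (trig_cst 0) _ => z; rewrite im_pow0 mulr0.
- apply: trig_ext (trig_scale 2^-1 (trig_add (trig_re n)
    (trig_scale (-1) (trig_re n.+2)))) _ => z.
  rewrite 2!re_powS im_powS.
  transitivity (cy z * (cx z * im_pow n z + cy z * re_pow n z) +
    2^-1 * (1 - (cx z ^+ 2 + cy z ^+ 2)) * re_pow n z).
    by field.
  by rewrite cx2Dcy2 subrr mulr0 mul0r addr0.
- by apply: trig_ext (trig_add ihf ihg) _ => z; rewrite mulrDr.
- by apply: trig_ext (trig_scale c ih) _ => z; rewrite mulrCA.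
Qed.

Lemma trig_mul f g : trigpoly f -> trigpoly g -> trigpoly (fun z => f z * g z).
Proof.
move=> tf tg.
have tp n : trigpoly (fun z => re_pow n z * g z) /\ trigpoly (fun z => im_pow n z * g z).
  elim: n => [|n [ihr ihi]]; split.
  - by apply: trig_ext tg _ => z; rewrite re_pow0 mul1r.
  - by apply: trig_ext (trig_cst 0) _ => z; rewrite im_pow0 mul0r.
  - apply: trig_ext (trig_add (trig_mul_cx ihr)
      (trig_scale (-1) (trig_mul_cy ihi))) _ => z.
    by rewrite re_powS; ring.
  - apply: trig_ext (trig_add (trig_mul_cx ihi) (trig_mul_cy ihr)) _ => z.
    by rewrite im_powS; ring.
elim: tf => [n|n|{}f h _ ihf _ ihh|c {}f _ ih]; [exact: (tp n).1|exact: (tp n).2| |].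
- by apply: trig_ext (trig_add ihf ihh) _ => z; rewrite mulrDl.
- by apply: trig_ext (trig_scale c ih) _ => z; rewrite mulrA.
Qed.

Lemma trig_exp f n : trigpoly f -> trigpoly (fun z => f z ^+ n).
Proof.
move=> tf; elim: n => [|n ih]; first exact: trig_ext (trig_cst 1) _.
by apply: trig_ext (trig_mul tf ih) _ => z; rewrite exprS.
Qed.

Lemma measurable_re_im_pow n :
  measurable_fun setT (re_pow n) /\ measurable_fun setT (im_pow n).
Proof.
elim: n => [|n [ihr ihi]]; split.
- by rewrite (_ : re_pow 0 = cst 1)//; apply: funext => z; rewrite re_pow0.
- by rewrite (_ : im_pow 0 = cst 0)//; apply: funext => z; rewrite im_pow0.
- rewrite (_ : re_pow n.+1 = (cx \* re_pow n) \- (cy \* im_pow n)).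
    by apply: measurable_funB; apply: measurable_funM => //;
      [exact: measurable_cx|exact: measurable_cy].
  by apply: funext => z; rewrite re_powS.
- rewrite (_ : im_pow n.+1 = (cx \* im_pow n) \+ (cy \* re_pow n)).
    by apply: measurable_funD; apply: measurable_funM => //;
      [exact: measurable_cx|exact: measurable_cy].
  by apply: funext => z; rewrite im_powS.
Qed.

Lemma trig_measurable f : trigpoly f -> measurable_fun setT f.
Proof.
elim=> [n|n|{}f g _ mf _ mg|c {}f _ mf].
- exact: (measurable_re_im_pow n).1.
- exact: (measurable_re_im_pow n).2.
- exact: measurable_funD.
- by apply: measurable_funM.
Qed.

Lemma trig_bounded f : trigpoly f -> exists M, forall z, `|f z| <= M.
Proof.
elim=> [n|n|{}f g _ [M fM] _ [N gN]|c {}f _ [M fM]].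
- by exists 1; exact: re_pow_le1.
- by exists 1; exact: im_pow_le1.
- by exists (M + N) => z; rewrite (le_trans (ler_normD _ _))// lerD.
- by exists (`|c| * M) => z; rewrite normrM ler_wpM2l.
Qed.

Lemma trig_integral_eq (m1 m2 : {finite_measure set (borel_circle R) -> \bar R}) :
  (forall n, \int[m1]_z re_pow n z = \int[m2]_z re_pow n z) ->
  (forall n, \int[m1]_z im_pow n z = \int[m2]_z im_pow n z) ->
  forall f, trigpoly f -> \int[m1]_z f z = \int[m2]_z f z.
Proof.
move=> hr hi f.
have I (m : {finite_measure set (borel_circle R) -> \bar R}) h :
    trigpoly h -> m.-integrable setT (EFin \o h).
  by move=> th; apply: bounded_integrable;
    [exact: trig_measurable|exact: trig_bounded].
elim=> [n|n|{}f g tf ihf tg ihg|c {}f tf ih] //.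
- by rewrite !RintegralD ?ihf ?ihg//; exact: I.
- by rewrite !RintegralZl ?ih//; exact: I.
Qed.

End TrigPoly.

(** * Polynomial approximation of a step function *)

Section Step.
Context {R : realType}.
Implicit Types (s t r : R).

(** On [0, 1], these polynomials take values in [0, 1] and converge to the
    indicator function of t < 1/2. With K = n 2^n, one has K t^n = n (2 t)^n,
    which tends to 0 for t < 1/2 and to infinity for t >= 1/2; the factor n
    takes care of the case t = 1/2. *)
Definition step_poly n t : R := (1 - t ^+ n) ^+ (n * 2 ^ n).

Lemma bernoulli_lower s k : 0 <= s <= 1 -> 1 - k%:R * s <= (1 - s) ^+ k.
Proof.
move=> /andP[s0 s1]; elim: k => [|k ih]; first by rewrite mul0r subr0 expr0.
rewrite exprS; apply: (@le_trans _ _ ((1 - s) * (1 - k%:R * s))).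
  rewrite -natr1; have : 0 <= k%:R * s ^+ 2 :> R by rewrite mulr_ge0 ?sqr_ge0.
  by nra.
by rewrite ler_wpM2l// subr_ge0.
Qed.

Lemma bernoulli_upper s k : 0 <= s <= 1 -> (1 - s) ^+ k * (1 + k%:R * s) <= 1.
Proof.
move=> /andP[s0 s1]; elim: k => [|k ih]; first by rewrite mul0r addr0 mulr1.
apply: le_trans ih; rewrite exprSr -mulrA ler_wpM2l ?exprn_ge0 ?subr_ge0//.
by rewrite -natr1; have : 0 <= k%:R :> R by []; nra.
Qed.

Lemma step_poly_ge0 n t : 0 <= t <= 1 -> 0 <= step_poly n t.
Proof. by move=> /andP[t0 t1]; rewrite exprn_ge0// subr_ge0 exprn_ile1. Qed.

Lemma step_poly_le1 n t : 0 <= t <= 1 -> step_poly n t <= 1.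
Proof.
move=> /andP[t0 t1]; rewrite exprn_ile1 ?subr_ge0 ?exprn_ile1//.
by rewrite gerBl exprn_ge0.
Qed.

(** Each term of 1 + r + ... + r^(n-1) is at least r^n. *)
Lemma natr_mul_expr_le r n : 0 <= r <= 1 -> n%:R * r ^+ n * (1 - r) <= 1 - r ^+ n.
Proof.
move=> /andP[r0 r1]; elim: n => [|n ih]; first by rewrite !mul0r subrr.
rewrite -natr1 exprS; set p := r ^+ n in ih *.
have p0 : 0 <= p by rewrite exprn_ge0.
have p1 : p <= 1 by rewrite exprn_ile1.
have h : r * (n%:R * p * (1 - r)) <= r * (1 - p) by rewrite ler_wpM2l.
have : 0 <= (1 - r) * (1 - r * p).
  by rewrite mulr_ge0// subr_ge0// mulr_ile1.
by nra.
Qed.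

Lemma cvg_natr_mul_expr r : 0 <= r < 1 -> n%:R * r ^+ n @[n --> \oo] --> 0.
Proof.
(* With u^2 = r, n u^n is bounded and n r^n is n u^n times u^n. *)
move=> /andP[r0 r1]; pose u := Num.sqrt r.
have u2 : r = u * u by rewrite -expr2 sqr_sqrtr.
have u0 : 0 <= u by exact: sqrtr_ge0.
have u1 : u < 1 by rewrite -[ltRHS]sqrtr1 ltr_sqrt.
apply: (@squeeze_cvgr _ _ _ _ (cst 0) (fun n => (1 - u)^-1 * u ^+ n)).
- apply: nearW => n; rewrite mulr_ge0 ?exprn_ge0//=.
  rewrite [leRHS]mulrC ler_pdivlMr ?subr_gt0// u2 exprMn.
  have -> : n%:R * (u ^+ n * u ^+ n) * (1 - u) = n%:R * u ^+ n * (1 - u) * u ^+ n.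
    by ring.
  rewrite ler_piMl ?exprn_ge0//.
  apply: (le_trans (natr_mul_expr_le n _)); first by rewrite u0 ltW.
  by rewrite gerBl exprn_ge0.
- exact: cvg_cst.
- rewrite -[X in _ --> X](mulr0 (1 - u)^-1); apply: cvgMl_tmp.
  by apply: cvg_expr; rewrite ger0_norm.
Qed.

Lemma step_poly_cvg t : 0 <= t <= 1 ->
  step_poly n t @[n --> \oo] --> ((t < 2^-1)%R%:R : R).
Proof.
move=> t01; have /andP[t0 t1] := t01.
have e n : (n * 2 ^ n)%:R * t ^+ n = n%:R * (2 * t) ^+ n :> R.
  by rewrite natrM natrX exprMn mulrA.
have tn n : 0 <= t ^+ n <= 1 by rewrite exprn_ge0//= exprn_ile1.
have [th|th] := ltP t 2^-1.
- apply: (@squeeze_cvgr _ _ _ _ (fun n => 1 - n%:R * (2 * t) ^+ n) (cst 1)).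
  + apply: nearW => n; rewrite step_poly_le1// andbT -e.
    exact: bernoulli_lower.
  + rewrite -[X in _ --> X]subr0; apply: cvgB; first exact: cvg_cst.
    by apply: cvg_natr_mul_expr; lra.
  + exact: cvg_cst.
- apply: (@squeeze_cvgr _ _ _ _ (cst 0) (fun n => n.+1%:R^-1)).
  + apply: nearW => n; rewrite step_poly_ge0//=.
    rewrite -[leRHS]mul1r ler_pdivlMr// -natr1.
    apply: le_trans (bernoulli_upper (n * 2 ^ n) (tn n)).
    rewrite ler_wpM2l ?step_poly_ge0// addrC lerD2l e ler_peMr//.
    by rewrite exprn_ege1//; lra.
  + exact: cvg_cst.
  + exact: cvg_harmonic.
Qed.

End Step.

(** * Moments determine a finite measure on the circle *)

Section CircleMeasureUnique.
Context {R : realType}.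

(** An increasing affine function that maps [-1, 1] into [0, 1] and c to 1/2. *)
Definition affine01 (c t : R) : R := 2^-1 + (t - c) / (2 * (1 + `|c|)).

Lemma affine01_bound c t : `|t| <= 1 -> 0 <= affine01 c t <= 1.
Proof.
move=> t1; rewrite /affine01.
have c0 : 0 < 2 * (1 + `|c|) by have := normr_ge0 c; lra.
have : `|(t - c) / (2 * (1 + `|c|))| <= 2^-1.
  rewrite normrM normfV (gtr0_norm c0) ler_pdivrMr//.
  by apply: (le_trans (ler_normB _ _)); lra.
by rewrite ler_norml => /andP[h1 h2]; lra.
Qed.

Lemma affine01_lt c t : (affine01 c t < 2^-1) = (t < c).
Proof.
by rewrite /affine01 gtrDl pmulr_llt0 ?subr_lt0// invr_gt0.
Qed.

(** The part of the circle in the open quadrant Re z < a, Im z < b. *)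
Definition quadrant (a b : R) : set (borel_circle R) :=
  [set z | cx z < a] `&` [set z | cy z < b].

Lemma measurable_quadrant a b : measurable (quadrant a b).
Proof.
apply: measurableI.
- rewrite -[X in measurable X]setTI.
  rewrite (_ : [set z | _] = cx @^-1` `]-oo, a[).
    by apply: measurable_cx => //; exact: measurable_itv.
  by apply/seteqP; split=> z /=; rewrite in_itv.
- rewrite -[X in measurable X]setTI.
  rewrite (_ : [set z | _] = cy @^-1` `]-oo, b[).
    by apply: measurable_cy => //; exact: measurable_itv.
  by apply/seteqP; split=> z /=; rewrite in_itv.
Qed.

Lemma cx_le1 (z : borel_circle R) : `|cx z| <= 1.
Proof. by have := re_pow_le1 1 z; rewrite /re_pow expr1. Qed.

Lemma cy_le1 (z : borel_circle R) : `|cy z| <= 1.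
Proof. by have := im_pow_le1 1 z; rewrite /im_pow expr1. Qed.

(** Trigonometric polynomials that converge boundedly to the indicator function
    of a quadrant. *)
Definition quadrant_approx a b n (z : borel_circle R) : R :=
  step_poly n (affine01 a (cx z)) * step_poly n (affine01 b (cy z)).

Lemma trig_quadrant_approx a b n : trigpoly (quadrant_approx a b n).
Proof.
have ts c (f : borel_circle R -> R) : trigpoly f ->
    trigpoly (fun z => step_poly n (affine01 c (f z))).
  move=> tf; apply: trig_exp.
  have ta : trigpoly (fun z => affine01 c (f z)).
    apply: trig_ext (trig_add (trig_cst (2^-1 - c / (2 * (1 + `|c|))))
      (trig_scale (2 * (1 + `|c|))^-1 tf)) _ => z.
    by rewrite /affine01 mulrBl [_^-1 * _]mulrC; ring.
  apply: trig_ext (trig_add (trig_cst 1) (trig_scale (-1) (trig_exp n ta))) _ => z.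
  by rewrite mulN1r.
exact: trig_mul (ts _ _ trig_cx) (ts _ _ trig_cy).
Qed.

Lemma quadrant_approx_cvg a b z :
  quadrant_approx a b n z @[n --> \oo] --> (\1_(quadrant a b) z : R).
Proof.
rewrite indicE.
have -> : ((z \in quadrant a b)%:R : R) =
    (affine01 a (cx z) < 2^-1)%R%:R * (affine01 b (cy z) < 2^-1)%R%:R.
  rewrite !affine01_lt -natrM mulnb; congr (nat_of_bool _)%:R.
  apply/idP/idP => [|/andP[? ?]]; first by rewrite inE => -[-> ->].
  by rewrite inE.
apply: cvgM; apply: step_poly_cvg; apply: affine01_bound.
  exact: cx_le1.
exact: cy_le1.
Qed.

Lemma quadrant_integral_cvg
    (m : {finite_measure set (borel_circle R) -> \bar R}) a b :
  (\int[m]_z (quadrant_approx a b n z)%:E)%E @[n --> \oo] --> m (quadrant a b).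
Proof.
have -> : m (quadrant a b) = (\int[m]_z (\1_(quadrant a b) z)%:E)%E.
  by rewrite integral_indic ?setIT//; exact: measurable_quadrant.
apply: (@dominated_cvg _ _ _ m setT measurableT _ _ (cst 1%E)) => //.
- move=> n; apply/measurable_EFinP; apply: trig_measurable.
  exact: trig_quadrant_approx.
- move=> z _; apply/cvg_EFin; first exact: nearW.
  exact: quadrant_approx_cvg.
- by apply: (@bounded_integrable _ _ _ m (cst 1)) => //; exists 1 => z /=; rewrite normr1.
- move=> n z _; rewrite lee_fin normrM.
  have bz c t : `|t| <= 1 -> `|step_poly n (affine01 c t)| <= 1 :> R.
    move=> /(affine01_bound c) h.
    by rewrite ger0_norm ?step_poly_ge0 ?step_poly_le1.
  by rewrite mulr_ile1// bz// ?cx_le1 ?cy_le1.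
Qed.

Lemma quadrant_measure_eq
    (m1 m2 : {finite_measure set (borel_circle R) -> \bar R}) :
  (forall n, \int[m1]_z re_pow n z = \int[m2]_z re_pow n z) ->
  (forall n, \int[m1]_z im_pow n z = \int[m2]_z im_pow n z) ->
  forall a b, m1 (quadrant a b) = m2 (quadrant a b).
Proof.
move=> hr hi a b.
have h1 := @quadrant_integral_cvg m1 a b.
have h2 := @quadrant_integral_cvg m2 a b.
rewrite -(cvg_lim _ h1)// -(cvg_lim _ h2)//; congr (lim (_ @ \oo)).
apply: funext => n.
have I (m : {finite_measure set (borel_circle R) -> \bar R}) :
    (\int[m]_z (quadrant_approx a b n z)%:E)%E =
    (\int[m]_z quadrant_approx a b n z)%:E.
  rewrite /Rintegral fineK//; apply: integrable_fin_num => //.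
  by apply: bounded_integrable;
    [apply: trig_measurable|apply: trig_bounded]; exact: trig_quadrant_approx.
by rewrite !I (trig_integral_eq hr hi)//; exact: trig_quadrant_approx.
Qed.

End CircleMeasureUnique.

Section QuadrantGenerate.
Context {R : realType}.

Definition quadrants : set (set (borel_circle R)) :=
  [set Q | exists a b, Q = quadrant a b].

Lemma setI_closed_quadrants : setI_closed quadrants.
Proof.
move=> _ _ [a [b ->]] [c [d ->]].
exists (Num.min a c), (Num.min b d).
apply/seteqP; split=> z /=; rewrite /quadrant /= !lt_min.
  by move=> [[-> ->] [-> ->]].
by move=> [/andP[-> ->] /andP[-> ->]].
Qed.

Lemma quadrant_setT (a b : R) : 1 < a -> 1 < b -> quadrant a b = setT.
Proof.
move=> a1 b1; apply/seteqP; split=> // z _; split=> /=.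
  by apply: le_lt_trans a1; apply: le_trans (cx_le1 z); exact: ler_norm.
by apply: le_lt_trans b1; apply: le_trans (cy_le1 z); exact: ler_norm.
Qed.

Lemma quadrant_cx (a : R) : quadrant a 2 = [set z | cx z < a].
Proof.
apply/seteqP; split=> z /=; first by case.
move=> za; split=> //=; apply: (@le_lt_trans _ _ 1); last lra.
by apply: le_trans (cy_le1 z); exact: ler_norm.
Qed.

Lemma quadrant_cy (b : R) : quadrant 2 b = [set z | cy z < b].
Proof.
apply/seteqP; split=> z /=; first by case.
move=> za; split=> //=; apply: (@le_lt_trans _ _ 1); last lra.
by apply: le_trans (cx_le1 z); exact: ler_norm.
Qed.

(* The circle with the sigma-algebra generated by the quadrants; it is to be
   shown that every open set is measurable for it. *)
Let QT := g_sigma_algebraType quadrants.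

Lemma measurable_quadrants_cx : measurable_fun setT (cx : QT -> R).
Proof.
apply: (measurability _ (RGenInftyO.measurableE R)).
move=> _ [_ [a ->] <-]; rewrite setTI; apply: sub_sigma_algebra.
exists a, 2; rewrite quadrant_cx.
by apply/seteqP; split=> z /=; rewrite in_itv.
Qed.

Lemma measurable_quadrants_cy : measurable_fun setT (cy : QT -> R).
Proof.
apply: (measurability _ (RGenInftyO.measurableE R)).
move=> _ [_ [a ->] <-]; rewrite setTI; apply: sub_sigma_algebra.
exists 2, a; rewrite quadrant_cy.
by apply/seteqP; split=> z /=; rewrite in_itv.
Qed.

(** The part of the circle in the open square of center (p, q) and half-side
    r, with rational data so that there are countably many of them. *)
Definition box (p q r : rat) : set QT :=
  [set z | `|cx z - ratr p| < ratr r] `&` [set z | `|cy z - ratr q| < ratr r].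

Lemma measurable_box p q r : measurable (box p q r).
Proof.
have h (f : QT -> R) c e : measurable_fun setT f ->
    measurable [set z | `|f z - c| < e].
  move=> mf; rewrite -[X in measurable X]setTI.
  rewrite (_ : [set z | _] = f @^-1` `]c - e, c + e[).
    by apply: mf => //; exact: measurable_itv.
  by apply/seteqP; split=> z /=; rewrite in_itv/= distrC ltr_distlC.
by apply: measurableI; apply: h;
  [exact: measurable_quadrants_cx|exact: measurable_quadrants_cy].
Qed.

Lemma open_box (O : set (circle R)) (z : circle R) : open O -> O z ->
  exists p q r, box p q r `<=` O /\ box p q r z.
Proof.
move=> [A oA <-] Az.
have /nbhs_ballP[e /= e0 eA] : nbhs (set_val z : Cplx R) A by exact: open_nbhs_nbhs.
pose d : R := complex.Re e.
have ed : e = (d%:C)%C by rewrite /d RRe_real// gtr0_real.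
have d0 : 0 < d by rewrite -ltcR -ed.
(* Two points of a square of half-side r are at distance less than 4 r. *)
have /rat_in_itvoo[r] : 0 < d / 4 by lra.
rewrite in_itv/= => /andP[r0 rd].
have /rat_in_itvoo[p] : cx z - ratr r < cx z + ratr r by lra.
have /rat_in_itvoo[q] : cy z - ratr r < cy z + ratr r by lra.
rewrite !in_itv /= -!ltr_distlC => zq zp.
exists p, q, r; split; last by split.
move=> w [/= wp wq]; apply: eA; rewrite -ball_normE /=.
apply: (le_lt_trans (norm_le_ReDIm _)); rewrite ed ltcR !raddfB /=.
rewrite -/(cx z) -/(cx w) -/(cy z) -/(cy w).
have : `|cx z - cx w| < ratr r + ratr r.
  by rewrite -(subrKA (ratr p)) (le_lt_trans (ler_normD _ _))// ltrD// distrC.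
have : `|cy z - cy w| < ratr r + ratr r.
  by rewrite -(subrKA (ratr q)) (le_lt_trans (ler_normD _ _))// ltrD// distrC.
by lra.
Qed.

Lemma open_quadrants (O : set (circle R)) : open O -> <<s quadrants>> O.
Proof.
move=> oO.
pose B p q r : set QT := if `[< box p q r `<=` O >] then box p q r else set0.
have -> : O = \bigcup_p \bigcup_q \bigcup_r B p q r.
  apply/seteqP; split=> [z /(open_box oO)[p [q [r [bO bz]]]]|z].
    by exists p => //; exists q => //; exists r => //; rewrite /B asboolT.
  by move=> [p _ [q _ [r _]]]; rewrite /B; case: asboolP => // bO /bO.
have mB p q r : measurable (B p q r).
  by rewrite /B; case: asboolP => _ //; exact: measurable_box.
apply: (@bigcupT_measurable_rat _ QT) => p.
by do 2 (apply: bigcupT_measurable_rat => ?).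
Qed.

Lemma borel_circle_quadrants : @measurable _ (borel_circle R) = <<s quadrants>>.
Proof.
apply/seteqP; split.
  by apply: smallest_sub; [exact: smallest_sigma_algebra|exact: open_quadrants].
apply: smallest_sub; first exact: sigma_algebra_measurable.
by move=> _ [a [b ->]]; exact: measurable_quadrant.
Qed.

(** Uniqueness of the trigonometric moment problem. *)
Theorem circle_measure_unique
    (m1 m2 : {finite_measure set (borel_circle R) -> \bar R}) :
  (forall n, \int[m1]_z re_pow n z = \int[m2]_z re_pow n z) ->
  (forall n, \int[m1]_z im_pow n z = \int[m2]_z im_pow n z) ->
  forall A, measurable A -> m1 A = m2 A.
Proof.
move=> hr hi A.
apply: (measure_unique quadrants (fun=> setT)).
- exact: borel_circle_quadrants.
- exact: setI_closed_quadrants.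
- by move=> _; exists 2, 2; rewrite quadrant_setT//; lra.
- by apply/seteqP; split=> // z _; exists 0%N.
- by move=> _ [a [b ->]]; exact: quadrant_measure_eq.
- by move=> _; rewrite ltey_eq fin_num_measure.
Qed.

End QuadrantGenerate.

(** * The arc length and its moments *)

Section ArcLength.
Context {R : realType}.

Lemma cis_continuous : continuous (@cis R : R -> circle R).
Proof.
apply: continuous_comp_initial => t.
apply/(@cvgrPdist_lt (Cplx R) (Cplx R) _ _ (nbhs_filter t)) => e e0.
have ed : e = ((complex.Re e)%:C)%C by rewrite RRe_real// gtr0_real.
have d0 : 0 < complex.Re e / 2 by rewrite divr_gt0// -ltcR -ed.
have /cvgrPdist_lt/(_ _ d0) hc := @continuous_cos R t.
have /cvgrPdist_lt/(_ _ d0) hs := @continuous_sin R t.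
apply: filterS2 hc hs => u hc hs.
apply: (le_lt_trans (norm_le_ReDIm _)); rewrite ed ltcR /=.
by rewrite [ltRHS](splitr (complex.Re e)) ltrD.
Qed.

Lemma measurable_cis : measurable_fun setT (@cis R : R -> borel_circle R).
Proof.
apply: (@measurability _ _ R (borel_circle R) setT _ (@open (circle R))) => //.
move=> _ [A oA <-]; rewrite setTI; apply: open_measurable.
by have /continuousP h := cis_continuous; exact: h.
Qed.

Lemma pow_cis n (t : R) : re_pow n (cis t : borel_circle R) = cos (n%:R * t) /\
  im_pow n (cis t : borel_circle R) = sin (n%:R * t).
Proof.
elim: n => [|n [ihr ihi]]; first by rewrite re_pow0 im_pow0 mul0r cos0 sin0.
rewrite re_powS im_powS ihr ihi -natr1 mulrDl mul1r [_ + t]addrC cosD sinD.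
by split=> //; rewrite addrC.
Qed.

End ArcLength.

Section ArcMoments.
Context {R : realType}.

Let I : set R := `[0, 2 * pi[.
Let mI : measurable I. Proof. exact: measurable_itv. Qed.
Let pi20 : 0 < 2 * pi :> R. Proof. by rewrite mulr_gt0// pi_gt0. Qed.
Let leb : {measure set (measurableTypeR R) -> \bar R} := mrestr (@lebesgue_measure R) mI.

(** The arc length as a measure: the image by cis of the Lebesgue measure
    restricted to [0, 2 pi[. *)
Definition arc_measure : set (borel_circle R) -> \bar R :=
  pushforward leb (@cis R : R -> borel_circle R).

Lemma arc_measureE F : arc_measure F = arc_length F.
Proof. by rewrite /arc_length /arc_measure /pushforward /leb /mrestr setIC. Qed.

Lemma arc_measure_setT : arc_measure setT = (2 * pi)%:E.
Proof.
rewrite arc_measureE /arc_length preimage_setT setIT lebesgue_measure_itv/=.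
by rewrite lte_fin pi20 sube0.
Qed.

Let arc_measure0 : arc_measure set0 = 0%E.
Proof. by apply: measure0; exact: measurable_cis. Qed.

Let arc_measure_ge0 A : (0 <= arc_measure A)%E.
Proof. by apply: measure_ge0; exact: measurable_cis. Qed.

Let arc_measure_sigma_additive : semi_sigma_additive arc_measure.
Proof. by apply: measure_semi_sigma_additive; exact: measurable_cis. Qed.

HB.instance Definition _ := isMeasure.Build _ _ _ arc_measure
  arc_measure0 arc_measure_ge0 arc_measure_sigma_additive.

Let arc_measure_finite : fin_num_fun arc_measure.
Proof.
move=> A mA; rewrite ge0_fin_numE//.
apply: (@le_lt_trans _ _ (arc_measure setT)); first by apply: le_measure; rewrite ?inE.
by rewrite arc_measure_setT ltry.
Qed.

HB.instance Definition _ := Measure_isFinite.Build _ _ _ arc_measure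
  arc_measure_finite.

Lemma integral_arc_measure (f : borel_circle R -> R) : trigpoly f ->
  (\int[arc_measure]_z (f z)%:E =
   \int[lebesgue_measure]_(t in `[0%R, (2 * pi)%R]) (f (cis t))%:E)%E.
Proof.
move=> tf.
have mf := trig_measurable tf.
have [M fM] := trig_bounded tf.
have mfc : measurable_fun setT (fun t : R => f (cis t)).
  exact: (measurableT_comp mf measurable_cis).
have lebT : leb setT = (2 * pi)%:E.
  by have := arc_measure_setT; rewrite /arc_measure /pushforward preimage_setT.
have intf : leb.-integrable setT (EFin \o (fun t : R => f (cis t))).
  apply: measurable_bounded_integrable => //.
    by rewrite lebT ltry.
  exists M; split; first exact: num_real.
  by move=> N MN t _ /=; apply: le_trans (fM _) (ltW MN).
rewrite /arc_measure integral_pushforward//=; last exact/measurable_EFinP.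
transitivity (\int[leb]_(x in setT) (f (cis x))%:E)%E; first by rewrite preimage_setT.
have mCI : measurable (~` I : set (measurableTypeR R)) by exact: measurableC.
have nCI : leb (~` I) = 0%E.
  have -> : leb (~` I) = lebesgue_measure (~` I `&` I) by [].
  by rewrite setICl measure0.
have := negligible_integral mCI (@measurableT _ (measurableTypeR R)) intf nCI.
rewrite setTD setCK /= => ->.
rewrite -integral_itv_bndo_bndc; last first.
  by apply/measurable_EFinP; exact: measurable_funTS.
apply: eq_measure_integral => A mA AI.
  have -> : leb A = lebesgue_measure (A `&` I) by [].
  by rewrite setIidl.
exact: measurable_cis.
Qed.

(** A function with a 2 pi-periodic primitive has integral 0 over a period. *)
Lemma integral_period_eq0 (f F : R -> R) :
  (forall t : R, is_derive t 1 F (f t)) -> continuous f -> F (2 * pi) = F 0 ->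
  (\int[lebesgue_measure]_(t in `[0%R, (2 * pi)%R]) (f t)%:E = 0)%E.
Proof.
move=> dF cf F0.
have cF : continuous F.
  move=> t; apply/differentiable_continuous/derivable1_diffP.
  exact: ex_derive.
rewrite (@continuous_FTC2 _ f F)// ?F0 ?subee//.
- exact: continuous_subspaceT.
- split; first by move=> t _; exact: ex_derive.
    by apply: cvg_at_right_filter; exact: cF.
  by apply: cvg_at_left_filter; exact: cF.
- by move=> t _; rewrite derive1E; exact: derive_val.
Qed.

Let cos_sin_2pi n : cos (n%:R * (2 * pi)) = 1 :> R /\ sin (n%:R * (2 * pi)) = 0 :> R.
Proof.
elim: n => [|n [ihc ihs]]; first by rewrite mul0r cos0 sin0.
have -> : n.+1%:R * (2 * pi) = n%:R * (2 * pi) + pi *+ 2 :> R.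
  by rewrite -natr1 mulrDl mul1r -[pi *+ 2]mulr_natl.
by rewrite sinD2pi cosD2pi.
Qed.

Lemma arc_moments n :
  \int[arc_measure]_z re_pow n z = (if n is 0%N then 2 * pi else 0) /\
  \int[arc_measure]_z im_pow n z = 0.
Proof.
rewrite /Rintegral !integral_arc_measure; try exact: trig_re; try exact: trig_im.
case: n => [|n]; split.
- under eq_integral do rewrite re_pow0.
  by rewrite integral_cst//= mul1e lebesgue_measure_itv/= lte_fin pi20 sube0.
- by under eq_integral do rewrite im_pow0; rewrite integral0.
- under eq_integral do rewrite (pow_cis _ _).1.
  pose F (t : R) := n.+1%:R^-1 * sin (n.+1%:R * t).
  have dF (t : R) : is_derive t 1 F (cos (n.+1%:R * t)).
    apply: is_derive_eq.
    by rewrite /GRing.scale/= ?(mulr0, mulr1, add0r, addr0); field.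
  have cf : continuous (fun t : R => cos (n.+1%:R * t)).
    by move=> t; apply: continuous_comp; [exact: mulrl_continuous|exact: continuous_cos].
  by rewrite (integral_period_eq0 dF cf)// /F (cos_sin_2pi _).2 !mulr0 sin0 mulr0.
- under eq_integral do rewrite (pow_cis _ _).2.
  pose F (t : R) := - (n.+1%:R^-1 * cos (n.+1%:R * t)).
  have dF (t : R) : is_derive t 1 F (sin (n.+1%:R * t)).
    apply: is_derive_eq.
    by rewrite /GRing.scale/= ?(mulr0, mulr1, add0r, addr0); field.
  have cf : continuous (fun t : R => sin (n.+1%:R * t)).
    by move=> t; apply: continuous_comp; [exact: mulrl_continuous|exact: continuous_sin].
  by rewrite (integral_period_eq0 dF cf)// /F (cos_sin_2pi _).1 mulr0 cos0.
Qed.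

End ArcMoments.

(** * Scalar measures of a projection-valued measure *)

Section ProjectionMeasure.
Context {R : realType} {H : hilbertType R}.
Variable E : projection_measure (borel_circle R) H.
Implicit Types (F A B : set (borel_circle R)) (x y : H).

Local Notation mu x := (scalar_measure E x).

Lemma scalar_measure_sqn x F : mu x F = (sqn (E F x))%:E.
Proof. by []. Qed.

Lemma scalar_measure_finite x : fin_num_fun (mu x).
Proof. by []. Qed.

HB.instance Definition _ x := Measure_isFinite.Build _ _ _ (mu x)
  (@scalar_measure_finite x).

Lemma scalar_measure_setT x : mu x setT = (sqn x)%:E.
Proof. by rewrite scalar_measure_sqn pm_setT. Qed.

Lemma pm_ortho A B x y : measurable A -> measurable B -> A `&` B = set0 ->
  inner (E A x) (E B y) = 0.
Proof.
by move=> mA mB AB; rewrite pm_selfadjoint// -pm_setI// AB pm_set0 linear0r.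
Qed.

Lemma reip_pm A x : measurable A -> reip x (E A x) = sqn (E A x).
Proof.
by move=> mA; rewrite /sqn /reip pm_selfadjoint// pm_idem.
Qed.

(** By additivity of the scalar measures, x - E(A)x - E(~A)x has norm 0. *)
Lemma pm_setC A x : measurable A -> x = E A x + E (~` A) x.
Proof.
move=> mA; have mC : measurable (~` A) by exact: measurableC.
apply/esym/eqP; rewrite -subr_eq0 -opprB oppr_eq0 opprD addrA; apply/eqP/sqn_eq0.
rewrite sqnB sqnB reipBl reip_pm// !reip_pm//.
have -> : reip (E A x) (E (~` A) x) = 0.
  by rewrite /reip pm_ortho// setICr.
have : mu x setT = (mu x A + mu x (~` A))%E.
  by rewrite -measureU// ?setUv ?setICr.
rewrite scalar_measure_setT !scalar_measure_sqn -EFinD => -[->].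
ring.
Qed.

(** For x and y in the ranges of the projections of two disjoint sets, the
    cross terms <E(F)x, E(F)y> vanish. *)
Lemma scalar_measureD A B x y F : measurable A -> measurable B -> A `&` B = set0 ->
  E A x = x -> E B y = y -> measurable F -> mu (x + y) F = (mu x F + mu y F)%E.
Proof.
move=> mA mB AB Ax By mF; rewrite !scalar_measure_sqn linearD sqnD -EFinD.
suff -> : reip (E F x) (E F y) = 0 by rewrite mulr0 addr0.
rewrite -Ax -By -!pm_setI// /reip pm_ortho//; try exact: measurableI.
by rewrite setIACA AB setI0.
Qed.

(** Bounded measurable functions; they are integrable for every finite
    measure. *)
Definition tame (f : borel_circle R -> R) :=
  measurable_fun setT f /\ exists M, forall z, `|f z| <= M.

Lemma tame_integrable f (m : {finite_measure set (borel_circle R) -> \bar R}) :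
  tame f -> m.-integrable setT (EFin \o f).
Proof. by move=> [mf bf]; exact: bounded_integrable. Qed.

Lemma integral_scalar_measureD A B x y f : measurable A -> measurable B ->
  A `&` B = set0 -> E A x = x -> E B y = y -> tame f ->
  \int[mu (x + y)]_z f z = \int[mu x]_z f z + \int[mu y]_z f z.
Proof.
move=> mA mB AB Ax By tf.
have ix := tame_integrable (mu x) tf; have iy := tame_integrable (mu y) tf.
rewrite /Rintegral -fineD; try exact: integrable_fin_num.
rewrite -integral_measure_add//; congr fine.
apply: eq_measure_integral => F mF _.
transitivity (mu x F + mu y F)%E.
  exact: scalar_measureD mA mB AB Ax By mF.
by rewrite /measure_add/= /msum !big_ord_recl/= big_ord0 adde0.
Qed.

(** For x in the range of E(A), the measure <E(.)x, x> is concentrated on A and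
    has mass |x|^2. *)
Lemma integral_concentrated_ge A x f c : measurable A -> E A x = x -> tame f ->
  (forall z, A z -> c <= f z) -> c * sqn x <= \int[mu x]_z f z.
Proof.
move=> mA Ax tf cf.
have ix := tame_integrable (mu x) tf.
have mC : measurable (~` A) by exact: measurableC.
have nC : mu x (~` A) = 0%E.
  rewrite scalar_measure_sqn -Ax -pm_setI// setICl pm_set0.
  by rewrite /sqn reip0l.
rewrite /Rintegral (negligible_integral mC _ ix nC)// setTD setCK.
have iA : (mu x).-integrable A (EFin \o f) by exact: integrableS ix.
have -> : c * sqn x = \int[mu x]_(z in A) c.
  by rewrite Rintegral_cst// [fine _]/(sqn (E A x)) Ax.
apply: le_Rintegral => //.
by apply: integrableS (tame_integrable (mu x) _) => //; split => //; exists `|c|.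
Qed.

Lemma integral_concentrated_le A x f c : measurable A -> E A x = x -> tame f ->
  (forall z, A z -> f z <= c) -> \int[mu x]_z f z <= c * sqn x.
Proof.
move=> mA Ax tf fc; rewrite -lerN2.
have -> : - (\int[mu x]_z f z) = \int[mu x]_z (-1 * f z).
  by rewrite RintegralZl ?mulN1r//; exact: tame_integrable.
rewrite -mulNr; apply: (integral_concentrated_ge mA Ax).
  case: tf => mf [M fM]; split; first exact: measurable_funM.
  by exists M => z; rewrite mulN1r normrN.
by move=> z Az; rewrite mulN1r lerN2 fc.
Qed.

End ProjectionMeasure.

(** * Locality of an operator with respect to its spectral measure *)

Section SpectralMoments.
Context {R : realType} {H : hilbertType R}.
Variables (U : {linear H -> H}) (E : projection_measure (borel_circle R) H).
Hypotheses (uU : unitary U) (UE : spectral_measure_of U E).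
Implicit Types (F A B : set (borel_circle R)) (x y : H).

Local Notation mu x := (scalar_measure E x).

Lemma tame_trig (f : borel_circle R -> R) : trigpoly f -> tame f.
Proof. by move=> tf; split; [exact: trig_measurable|exact: trig_bounded]. Qed.

Lemma spectral_form x :
  inner (U x) x = ((\int[mu x]_z cx z) +i* (\int[mu x]_z cy z))%C.
Proof. exact: UE. Qed.

(** Ranges of the projections of disjoint sets are orthogonal, and remain so
    after applying U to one of them: this is the polarization of the integral formula, the
    integrals being additive on such pairs of vectors. *)
Lemma spectral_ortho A B x y : measurable A -> measurable B -> A `&` B = set0 ->
  E A x = x -> E B y = y -> inner (U x) y = 0.
Proof.
move=> mA mB AB Ax By.
(* The vectors y and i y give two equations, which determine <Ux, y>. *)
have cross v : E B v = v -> inner (U x) v + inner (U v) x = 0.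
  move=> Bv; have := spectral_form (x + v).
  rewrite !(integral_scalar_measureD mA mB AB Ax Bv (tame_trig _));
    [|exact: trig_cy|exact: trig_cx].
  rewrite [U (x + v)]linearD linearDl !linearDr /= !spectral_form.
  set a := inner (U x) v; set b := inner (U v) x.
  case: a b => [a1 a2] [b1 b2] [] h1 h2.
  by apply/eqP; rewrite eq_complex /=; apply/andP; split; apply/eqP; lra.
have Biy : E B (('i%C : Cplx R) *: y) = ('i%C : Cplx R) *: y by rewrite linearZ By.
have := cross _ Biy; have := cross _ By.
rewrite [U (_ *: y)]linearZ innerZl innerZr /=.
case: (inner (U x) y) (inner (U y) x) => [a1 a2] [b1 b2].
move=> /eqP; rewrite eq_complex /= => /andP[/eqP h1 /eqP h2].
move=> /eqP; rewrite eq_complex /= => /andP[/eqP h3 /eqP h4].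
by apply/eqP; rewrite eq_complex /=; apply/andP; split; apply/eqP; lra.
Qed.

(** The range of E(A) is invariant under U: E(~A)Ux has norm 0. *)
Lemma spectral_invariant A x : measurable A -> E A x = x -> E A (U x) = U x.
Proof.
move=> mA Ax; have mC : measurable (~` A) by exact: measurableC.
suff C0 : E (~` A) (U x) = 0 by rewrite [RHS](pm_setC E _ mA) C0 addr0.
apply: sqn_eq0; rewrite -reip_pm// /reip.
by rewrite (spectral_ortho mA mC (setICr A) Ax)// pm_idem.
Qed.

Lemma spectral_invariant_iter A x n : measurable A -> E A x = x ->
  E A (iter n U x) = iter n U x.
Proof. by move=> mA Ax; elim: n => // n ih; rewrite iterS spectral_invariant. Qed.

Lemma iter_linearD n x y : iter n U (x + y) = iter n U x + iter n U y.
Proof. by elim: n => // n ih; rewrite !iterS ih linearD. Qed.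

(** On the range of E(A), for A contained in a square of half-side d around z0,
    U is close to the multiplication by z0. Indeed
    |Ux - z0 x|^2 = 2 (|x|^2 - Re (conj z0 <Ux, x>)), and on A
    Re (conj z0 z) = 1 - |z - z0|^2 / 2 >= 1 - d^2. *)
Lemma approx_eigen A x (z0 : borel_circle R) (d : R) : measurable A -> E A x = x ->
  0 <= d ->
  (forall z, A z -> `|cx z - cx z0| <= d /\ `|cy z - cy z0| <= d) ->
  `|U x - (set_val z0 : Cplx R) *: x| <= ((2 * d)%:C)%C * `|x|.
Proof.
move=> mA Ax d0 Ad.
rewrite norm_sqn norm_sqn -rmorphM lecR.
have -> : 2 * d * Num.sqrt (sqn x) = Num.sqrt ((2 * d) ^+ 2 * sqn x).
  by rewrite sqrtrM ?sqr_ge0// sqrtr_sqr ger0_norm// mulr_ge0.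
rewrite ler_wsqrtr// sqnB sqnZ unitary_sqn//.
rewrite /reip innerZr spectral_form set_val_circle /=.
pose f z : R := cx z0 * cx z + cy z0 * cy z.
have tf : trigpoly f.
  by apply: trig_add; apply: trig_scale; [exact: trig_cx|exact: trig_cy].
have I (h : borel_circle R -> R) : trigpoly h -> (mu x).-integrable setT (EFin \o h).
  by move=> th; exact: (@tame_integrable _ _ (mu x) (tame_trig th)).
have := integral_concentrated_ge (c := 1 - d ^+ 2) mA Ax (tame_trig tf).
rewrite RintegralD//; first last.
- by apply: I; apply: trig_scale; exact: trig_cy.
- by apply: I; apply: trig_scale; exact: trig_cx.
rewrite !RintegralZl//; try (by apply: I; exact: trig_cx); try (by apply: I; exact: trig_cy).
move=> h.
have {h} : (1 - d ^+ 2) * sqn x <=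
    cx z0 * \int[mu x]_z cx z + cy z0 * \int[mu x]_z cy z.
  apply: h => z /Ad[hx hy]; rewrite /f.
  have := cx2Dcy2 z; have := cx2Dcy2 z0.
  have : (cx z - cx z0) ^+ 2 <= d ^+ 2 by rewrite -real_normK ?num_real// lerXn2r ?nnegrE.
  have : (cy z - cy z0) ^+ 2 <= d ^+ 2 by rewrite -real_normK ?num_real// lerXn2r ?nnegrE.
  by nra.
have := cx2Dcy2 z0; have := sqn_ge0 x.
set s := sqn x; set X := \int[_]_z cx z; set Y := \int[_]_z cy z.
move=> s0 e0 h.
have -> : (cx z0 * cx z0 - cy z0 * - cy z0) * s = s.
  by rewrite mulrN opprK -!expr2 e0 mul1r.
have : 0 <= d ^+ 2 * s by rewrite mulr_ge0// sqr_ge0.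
by nra.
Qed.

End SpectralMoments.

(** * Moments of the scalar measures *)

Section MomentGap.
Context {R : realType} {H : hilbertType R}.
Variables (U : {linear H -> H}) (E : projection_measure (borel_circle R) H).
Hypotheses (uU : unitary U) (UE : spectral_measure_of U E).
Implicit Types (F A B : set (borel_circle R)) (x y : H).

Local Notation mu x := (scalar_measure E x).

Lemma approx_eigen_iter A x (z0 : borel_circle R) (d : R) n :
  measurable A -> E A x = x -> 0 <= d ->
  (forall z, A z -> `|cx z - cx z0| <= d /\ `|cy z - cy z0| <= d) ->
  `|iter n U x - (set_val z0 : Cplx R) ^+ n *: x| <=
  ((n%:R * (2 * d))%:C)%C * `|x|.
Proof.
move=> mA Ax d0 Ad; elim: n => [|n ih].
  by rewrite expr0 scale1r subrr normr0 mul0r mul0r.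
have -> : iter n.+1 U x - (set_val z0 : Cplx R) ^+ n.+1 *: x =
  U (iter n U x - (set_val z0 : Cplx R) ^+ n *: x) +
  (set_val z0 : Cplx R) ^+ n *: (U x - (set_val z0 : Cplx R) *: x).
  by rewrite [U (_ - _)]linearB [U (_ *: _)]linearZ scalerBr scalerA -exprSr addrA subrK.
rewrite (le_trans (ler_normD _ _))// unitary_norm// normrZ normrX norm_set_val expr1n mul1r.
rewrite -natr1 mulrDl mul1r rmorphD mulrDl lerD//.
exact: approx_eigen uU UE _ _ _ _ mA Ax d0 Ad.
Qed.

Variables (w : Cplx R) (n : nat).
Hypothesis w1 : `|w| = 1.

(* The function Re (w z^n); the case w = 1 gives Re z^n and the case w = -i
   gives Im z^n. *)
Let f (z : borel_circle R) : R :=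
  complex.Re w * re_pow n z + (- complex.Im w) * im_pow n z.

Let tf : trigpoly f.
Proof. by apply: trig_add; apply: trig_scale; [exact: trig_re|exact: trig_im]. Qed.

Let fE z : f z = complex.Re (w * (set_val z : Cplx R) ^+ n).
Proof.
by rewrite /f /re_pow /im_pow; case: w (_ ^+ n) => [a b] [c d] /=; ring.
Qed.

(** The difference between Re (w <U^n x, x>) and the integral of Re (w z^n) for
    <E(.)x, x>; it is 0 by [moment_gap_eq0]. *)
Definition moment_gap x : R := reip (w *: iter n U x) x - \int[mu x]_z f z.

Lemma moment_gapD A B x y : measurable A -> measurable B -> A `&` B = set0 ->
  E A x = x -> E B y = y -> moment_gap (x + y) = moment_gap x + moment_gap y.
Proof.
move=> mA mB AB Ax By; rewrite /moment_gap.
rewrite (integral_scalar_measureD mA mB AB Ax By (tame_trig tf)) iter_linearD.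
have h1 : inner (iter n U x) y = 0.
  by rewrite -(spectral_invariant_iter UE n mA Ax) -By pm_ortho.
have h2 : inner (iter n U y) x = 0.
  by rewrite -(spectral_invariant_iter UE n mB By) -Ax pm_ortho// setIC.
rewrite scalerDr !reipE [reip _ y in X in X + _]/reip.
rewrite innerZl h1 mulr0 [reip (w *: iter n U y) x]/reip innerZl h2 mulr0 /=.
by ring.
Qed.

Lemma moment_gap0 : moment_gap 0 = 0.
Proof.
have m0 : measurable (set0 : set (borel_circle R)) by [].
have := moment_gapD m0 m0 (setI0 _) (pm_set0 E 0) (pm_set0 E 0).
by rewrite addr0 => h; lra.
Qed.

(** On the range of E(A), the gap is at most e |x|^2. *)
Definition small_gap (e : R) A :=
  forall x, E A x = x -> `|moment_gap x| <= e * sqn x.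

(** A vector x in the range of E(A union B) is the sum of E(A)x and of a vector in
    the range of E(B \ A). *)
Lemma small_gapU e A B : measurable A -> measurable B ->
  small_gap e A -> small_gap e B -> small_gap e (A `|` B).
Proof.
move=> mA mB sA sB x ABx.
have mC : measurable (~` A) by exact: measurableC.
have xE := pm_setC E x mA.
have E1 : E A (E A x) = E A x by exact: pm_idem.
have E2 : E (~` A) (E (~` A) x) = E (~` A) x by exact: pm_idem.
have mAB : measurable (A `|` B) by exact: measurableU.
have mCB : measurable (~` A `&` B) by exact: measurableI.
have E4 : E (~` A) x = E (~` A `&` B) x.
  by rewrite -{1}ABx -(pm_setI E mC mAB) setIUr setICl set0U.
have E3 : E B (E (~` A) x) = E (~` A) x.
  by rewrite E4 -(pm_setI E mB mCB) setIC -setIA setIid.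
have s2 : sqn x = sqn (E A x) + sqn (E (~` A) x).
  by rewrite {1}xE sqnD /reip pm_ortho// ?setICr// mulr0 addr0.
rewrite {1}xE (moment_gapD mA mC _ E1 E2) ?setICr// s2 mulrDr.
by rewrite (le_trans (ler_normD _ _))// lerD; [|exact: sA|exact: sB].
Qed.

(** With z0 any point of A, replacing U^n x by z0^n x costs 2 n d |x|^2 on one
    side, and replacing z by z0 in the integral costs 2 n d |x|^2 on the
    other. *)
Lemma small_gap_cell A (d : R) : measurable A -> 0 <= d ->
  (forall z z0, A z -> A z0 -> `|cx z - cx z0| <= d /\ `|cy z - cy z0| <= d) ->
  small_gap (4 * n%:R * d) A.
Proof.
move=> mA d0 Ad x Ax.
have [A0|/set0P[z0 Az0]] := eqVneq A set0.
  have -> : x = 0 by rewrite -Ax A0 pm_set0.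
  by rewrite moment_gap0 normr0 /sqn reip0l mulr0.
have Az z : A z -> `|cx z - cx z0| <= d /\ `|cy z - cy z0| <= d.
  by move=> ?; exact: Ad.
have k0 : 0 <= n%:R * (2 * d) by rewrite mulr_ge0// mulr_ge0.
pose a : H := w *: (iter n U x - (set_val z0 : Cplx R) ^+ n *: x).
have ax : `|reip a x| <= n%:R * (2 * d) * sqn x.
  apply: reip_bound => //; rewrite normrZ w1 mul1r.
  exact: approx_eigen_iter Ax d0 Az.
have fz z : A z -> `|f z - f z0| <= n%:R * (2 * d).
  move=> /Az[hx hy]; rewrite !fE -raddfB /= -mulrBr -lecR.
  apply: le_trans (normc_ge_Re _) _; rewrite normrM w1 mul1r.
  apply: le_trans (norm_pow_diff z z0 n) _.
  rewrite rmorphM rmorph_nat ler_wpM2l// (le_trans (norm_le_ReDIm _))// lecR.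
  by rewrite !raddfB /= -/(cx z) -/(cx z0) -/(cy z) -/(cy z0); lra.
have gE : moment_gap x = reip a x + (f z0 * sqn x - \int[mu x]_z f z).
  rewrite /moment_gap addrA; congr (_ - _).
  rewrite /a scalerBr reipBl fE scalerA {3}/reip innerZl inner_sqn.
  by case: (w * _) => u v /=; ring.
rewrite gE.
have := integral_concentrated_ge (c := f z0 - n%:R * (2 * d)) mA Ax (tame_trig tf).
have := integral_concentrated_le (c := f z0 + n%:R * (2 * d)) mA Ax (tame_trig tf).
move=> hle hge.
have {}hle : \int[mu x]_z f z <= (f z0 + n%:R * (2 * d)) * sqn x.
  by apply: hle => z /fz; rewrite ler_distl => /andP[].
have {}hge : (f z0 - n%:R * (2 * d)) * sqn x <= \int[mu x]_z f z.
  by apply: hge => z /fz; rewrite ler_distl => /andP[].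
move: ax; rewrite !ler_norml => /andP[ax1 ax2].
move: (\int[_]_z f z) hle hge => I hle hge.
have : 0 <= n%:R * d * sqn x by rewrite !mulr_ge0// sqn_ge0.
by move: (n%:R) k0 ax1 ax2 hle hge => N *; apply/andP; split; nra.
Qed.

Lemma small_gap_bigU e k (F : nat -> set (borel_circle R)) :
  (forall i, measurable (F i)) -> (forall i, small_gap e (F i)) ->
  small_gap e (\big[setU/set0]_(i < k) F i).
Proof.
move=> mF sF; elim: k => [|k ih].
  rewrite big_ord0 => x; rewrite pm_set0 => <-.
  by rewrite moment_gap0 normr0 /sqn reip0l mulr0.
by rewrite big_ord_recr; apply: small_gapU => //; exact: bigsetU_measurable.
Qed.

(* The circle is cut into the strips i d <= g + 1 < (i + 1) d, for g either of
   the two coordinates, which take values in [-1, 1]. *)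
Let strip (g : borel_circle R -> R) (d : R) (i : nat) : set (borel_circle R) :=
  [set z | i%:R * d <= g z + 1 < i.+1%:R * d].

Let measurable_strip g d i : measurable_fun setT g -> measurable (strip g d i).
Proof.
move=> mg; rewrite -[X in measurable X]setTI.
rewrite (_ : strip g d i = g @^-1` `[i%:R * d - 1, i.+1%:R * d - 1[).
  by apply: mg => //; exact: measurable_itv.
by apply/seteqP; split=> z; rewrite /strip /= in_itv /= lerBlDr ltrBrDr.
Qed.

Let strip_diam g d i z z0 : strip g d i z -> strip g d i z0 -> `|g z - g z0| <= d.
Proof.
rewrite /strip /= -natr1 mulrDl mul1r ler_norml => /andP[? ?] /andP[? ?].
by apply/andP; split; lra.
Qed.

Let strip_cover (g : borel_circle R -> R) (d : R) (z : borel_circle R) :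
  0 < d -> `|g z| <= 1 ->
  (\big[setU/set0]_(i < (Num.truncn (2 / d)).+1) strip g d i) z.
Proof.
move=> d0; rewrite ler_norml => /andP[g1 g2].
rewrite -bigcup_mkord; exists (Num.truncn ((g z + 1) / d)) => /=.
  rewrite ltnS; apply: le_truncn; rewrite ler_pM2r ?invr_gt0//; lra.
have /truncn_itv/andP[h1 h2] : 0 <= (g z + 1) / d.
  by apply: divr_ge0; [lra|exact: ltW].
by rewrite /strip /= -ler_pdivlMr// h1 -ltr_pdivrMr.
Qed.

Lemma small_gap_setT (d : R) : 0 < d -> small_gap (4 * n%:R * d) setT.
Proof.
move=> d0; pose k := (Num.truncn (2 / d)).+1.
pose C i j := strip cx d i `&` strip cy d j.
have mC i j : measurable (C i j).
  by apply: measurableI; apply: measurable_strip; [exact: measurable_cx|exact: measurable_cy].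
have -> : setT = \big[setU/set0]_(i < k) \big[setU/set0]_(j < k) C i j.
  apply/esym/seteqP; split=> // z _.
  have [i ik iz] : (\bigcup_(i < k) strip cx d i) z.
    by rewrite bigcup_mkord; exact: strip_cover d0 (cx_le1 z).
  have [j jk jz] : (\bigcup_(j < k) strip cy d j) z.
    by rewrite bigcup_mkord; exact: strip_cover d0 (cy_le1 z).
  rewrite -(bigcup_mkord k (fun i => \big[setU/set0]_(j < k) C i j)).
  by exists i => //; rewrite -(bigcup_mkord k (C i)); exists j.
apply: (@small_gap_bigU _ _ (fun i => \big[setU/set0]_(j < k) C i j)) => i.
  by apply: bigsetU_measurable => j _.
apply: (@small_gap_bigU _ _ (C i)) => // j.
apply: small_gap_cell => // [|z z0 [zx zy] [z0x z0y]]; first exact: ltW.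
by split; [exact: strip_diam zx z0x|exact: strip_diam zy z0y].
Qed.

Lemma moment_gap_eq0 x : moment_gap x = 0.
Proof.
apply/eqP; rewrite -normr_le0 leNgt; apply/negP => g0.
set g := `|moment_gap x| in g0.
have K0 : 0 <= 4 * n%:R * sqn x by rewrite !mulr_ge0// sqn_ge0.
(* With this value of d, the bound 4 n d |x|^2 is less than g. *)
have d0 : 0 < g / (4 * n%:R * sqn x + 1) by rewrite divr_gt0// ltr_pwDr.
have := small_gap_setT d0 (pm_setT E x); rewrite -/g leNgt => /negP; apply.
rewrite mulrAC mulrA ltr_pdivrMr ?ltr_pwDr//.
by rewrite mulrDr mulr1 mulrC ltrDl.
Qed.

End MomentGap.

(** * The scalar measure of a wandering vector *)

Section WanderingMeasure.
Context {R : realType} {H : hilbertType R}.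
Variables (U : {linear H -> H}) (E : projection_measure (borel_circle R) H).
Hypotheses (uU : unitary U) (UE : spectral_measure_of U E).

Lemma spectral_moments n (x : H) :
  \int[scalar_measure E x]_z re_pow n z = complex.Re (inner (iter n U x) x) /\
  \int[scalar_measure E x]_z im_pow n z = complex.Im (inner (iter n U x) x).
Proof.
have w1 : `|1 : Cplx R| = 1 by exact: normr1.
have wi : `|((0 -i* 1)%C : Cplx R)| = 1.
  by rewrite normc_def /= expr0n add0r sqrrN expr1n sqrtr1.
have := moment_gap_eq0 uU UE n w1 x; have := moment_gap_eq0 uU UE n wi x.
rewrite /moment_gap scale1r /reip innerZl /= => /subr0_eq hi /subr0_eq hr.
split.
- rewrite hr; apply: eq_Rintegral => z _.
  by rewrite oppr0 mul0r addr0 mul1r.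
- transitivity (complex.Re (((0 -i* 1)%C : Cplx R) * inner (iter n U x) x)).
    rewrite hi; apply: eq_Rintegral => z _.
    by rewrite mul0r add0r opprK mul1r.
  by case: (inner _ _) => a b /=; ring.
Qed.

(** The vector v is the multiple of e with |v|^2 = 2 pi, the total arc
    length. *)
Lemma wandering_scalar_measure (e : H) :
  e != 0 -> (forall n, inner (iter n.+1 U e) e = 0) ->
  exists v : H, forall F, measurable F -> scalar_measure E v F = arc_length F.
Proof.
move=> e0 eU.
have s0 : 0 < sqn e.
  rewrite lt_neqAle sqn_ge0 andbT eq_sym.
  by apply: contraNneq e0 => /sqn_eq0 ->.
pose c : R := Num.sqrt (2 * pi / sqn e).
pose v : H := (c%:C)%C *: e.
have sv : sqn v = 2 * pi.
  rewrite /v /sqn reipZl reipZr -/(sqn e) mulrA -expr2 sqr_sqrtr ?divfK ?gt_eqF//.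
  by rewrite divr_ge0 ?ltW// mulr_gt0// pi_gt0.
have vU n : inner (iter n.+1 U v) v = 0.
  have -> : iter n.+1 U v = (c%:C)%C *: iter n.+1 U e.
    by elim: (n.+1) => // m ih; rewrite !iterS ih linearZ.
  by rewrite innerZl innerZr eU !mulr0.
exists v => F mF; rewrite -arc_measureE.
apply: (circle_measure_unique (m1 := scalar_measure E v) (m2 := arc_measure)) => // n.
- rewrite (spectral_moments n v).1 (arc_moments n).1.
  by case: n => [|n]; rewrite ?vU// inner_sqn sv.
- rewrite (spectral_moments n v).2 (arc_moments n).2.
  by case: n => [|n]; rewrite ?vU// inner_sqn.
Qed.

End WanderingMeasure.

(** * Non-reductivity and absolute continuity of the arc length *)

Theorem theorem7p2 (R : realType) (H : hilbertType R)
    (H_separable : separable H) (H_infinite : infinite_dimensional H)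
    (Gamma : groupType) (pi : Gamma -> {linear H -> H})
    (pi_unitary : unitary_representation pi)
    (G : set H) (G_nonempty : G !=set0)
    (pi_minimal : minimal_family (setT `*` G)
                    (fun p : Gamma * H => pi p.1 p.2))
    (gamma : Gamma) (gamma_infinite : infinite_order gamma) :
  ~ reductive (pi gamma) /\
  forall E : projection_measure (borel_circle R) H,
    spectral_measure_of (pi gamma) E -> arc_length_ac E.
Proof.
have [g Gg] := G_nonempty.
have gV := minimal_forward_span pi_unitary pi_minimal gamma_infinite Gg.
have [unit_pi _ _] := pi_unitary.
split; first exact: forward_span_nonreductive gV.
move=> E EU F mF EF0.
have [e e0 eU] := wandering_vector (unit_pi gamma) gV.
have [v vE] := wandering_scalar_measure (unit_pi gamma) EU e0 eU.
by rewrite -vE// scalar_measure_sqn EF0 /sqn reip0l.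
Qed.
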